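(* Let $n$ be a positive even integer. For even $\ell$ with $0\le\ell\le n-2$, let $\phi_\ell^n\colon W_{\ell+2}^n\to W_\ell^n$ be the maps defined in the context. These are homomorphisms of $\mathrm{TL}_n(0)$-modules and the sequence $$0\longrightarrow W_n^n\xrightarrow{\phi_{n-2}^n} W_{n-2}^n\xrightarrow{\phi_{n-4}^n}\cdots\xrightarrow{\phi_2^n} W_2^n\xrightarrow{\phi_0^n} W_0^n\longrightarrow 0$$ is exact. Moreover, the collection $\{\operatorname{im}\phi_\ell^n\mid 0\le\ell\le n-2,\ \ell\equiv0\pmod 2\}$ is the complete set of irreducible modules of $\mathrm{TL}_n(0)$.
   Context: **Temperley-Lieb algebra.** $\mathrm{TL}_n(0)$ is the $\mathbb{C}$-algebra generated by $e_1,\dots,e_{n-1}$ with relations $e_i^2=0$, $e_ie_{i\pm1}e_i=e_i$, $e_ie_j=e_je_i$ for $|i-j|\ge 2$. Equivalently it has as basis the planar (crossingless) string diagrams joining in pairs $n$ points on a top line and $n$ points on a bottom line, with product $ab$ given by placing $a$ above $b$; any diagram with a closed loop is $0$. The generator $e_i$ joins the $i$th and $(i+1)$th top points, joins the $i$th and $(i+1)$th bottom points, and joins every other top point vertically to the bottom point below it. **Standard modules.** In a planar diagram from $n$ top points to $\ell$ bottom points, curves joining two top points are cups, curves joining two bottom points are caps, and curves joining top to bottom are throughlines. For $0\le \ell\le n$ with $\ell\equiv n \pmod 2$, $W_\ell^n$ is the $\mathbb{C}$-vector space with basis the monic diagrams (those without caps) from $n$ top points to $\ell$ bottom points. $\mathrm{TL}_n(0)$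 acts by concatenation from above; a result containing a closed loop or a cap is $0$. **The maps $\phi_\ell^n$.** For a monic basis diagram $x\in W_{\ell+2}^n$ and $0\le i\le \ell$, $x\delta_i^\ell\in W_\ell^n$ is the diagram obtained from $x$ by connecting the $(i+1)$th and $(i+2)$th bottom points of $x$ (counted from the left) to each other, so that the corresponding two throughlines become one cup. The map $\phi_\ell^n\colon W_{\ell+2}^n\to W_\ell^n$ is the linear map with $\phi_\ell^n(x)=\sum_{i=0}^{\ell/2}(-1)^i x\delta_{2i}^\ell$ on basis diagrams. *)

(* Defs.v *)
From HB Require Import structures.
From mathcomp Require Import all_boot all_order all_algebra zify.
From mathcomp Require Import boolp.

Set Implicit Arguments.
Unset Strict Implicit.
Unset Printing Implicit Defensive.

Import GRing.Theory.

(* The boundary points of a diagram: n on the top line, m on the bottom line,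
   both numbered from the left. *)
Definition point n m := ('I_n + 'I_m)%type.

(* Position of a boundary point when going round the boundary clockwise: the
   top line from left to right, then the bottom line from right to left. *)
Definition place n m (p : point n m) : nat :=
  match p with inl i => i | inr j => n + (m - j.+1) end.

(* f sends each boundary point to the other end of its curve; the last clause
   says that no two curves cross. *)
Definition planar_pairing n m (f : {ffun point n m -> point n m}) : bool :=
  [&& [forall p, f p != p],
      [forall p, f (f p) == p] &
      [forall p, forall q,
         ~~ [&& place p < place q, place q < place (f p)
              & place (f p) < place (f q)]]].

Record diagram n m := Diagram {
  partner :> {ffun point n m -> point n m};
  partner_planar : planar_pairing partner }.

HB.instance Definition _ n m := [isSub for @partner n m].
HB.instance Definition _ n m := [Finite of diagram n m by <:].

Lemma partner_neq n m (x : diagram n m) p : x p != p.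
Proof. by case/and3P: (partner_planar x) => /forallP. Qed.

Lemma partnerK n m (x : diagram n m) : involutive x.
Proof.
by case/and3P: (partner_planar x) => _ /forallP xK _ p; apply/eqP.
Qed.

Lemma partner_nocross n m (x : diagram n m) p q :
  place p < place q -> place q < place (x p) -> place (x p) < place (x q) ->
  False.
Proof.
case/and3P: (partner_planar x) => _ _ /forallP/(_ p)/forallP/(_ q) H *.
by case/negP: H; apply/and3P.
Qed.

Lemma place_inj n m : injective (@place n m).
Proof.
by move=> [[i ?]|[j ?]] [[i' ?]|[j' ?]] /= H; try (exfalso; lia);
  congr (_ _); apply/val_inj => /=; lia.
Qed.

(* The disjoint union of the boundary points of x (above) and y (below), with
   the bottom line of x glued to the top line of y. *)
Definition glued n m l (x : diagram n m) (y : diagram m l) :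
    rel (point n m + point m l) := fun u v =>
  match u, v with
  | inl p, inl q => q == x p
  | inr p, inr q => q == y p
  | inl p, inr q | inr q, inl p =>
    match p, q with inr j, inl j' => j == j' | _, _ => false end
  end.

Definition outer n m l (p : point n l) : point n m + point m l :=
  match p with inl i => inl (inl i) | inr k => inr (inr k) end.

(* z is what remains of x above y, and no closed loop appears. *)
Definition is_concat n m l (x : diagram n m) (y : diagram m l)
    (z : diagram n l) : bool :=
  [forall p, forall q, connect (glued x y) (outer m p) (outer m q)
                       == ((q == p) || (q == z p))]
  && [forall u, exists p, connect (glued x y) u (outer m p)].

(* None stands for 0, the value when a closed loop appears; otherwise there is
   a unique z, by [joined_exists] and [is_concat_uniq] below. *)
Definition concat n m l (x : diagram n m) (y : diagram m l) :
    option (diagram n l) := [pick z | is_concat x y z].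

Section Joins.
Variables (n m l : nat) (x : diagram n m) (y : diagram m l).
Let T := (point n m + point m l)%type.

Let posT (u : T) : nat :=
  match u with inl p => place p | inr q => n + m + place q end.

Let gone k (u : T) : bool :=
  match u with inl (inr j) | inr (inl j) => j < k | _ => false end.

Let juxt (u : T) : T := match u with inl p => inl (x p) | inr q => inr (y q) end.

Let glue k : rel T := fun u v =>
  match u, v with
  | inl (inr j), inr (inl j') | inr (inl j'), inl (inr j) => (j < k) && (j == j')
  | _, _ => v == juxt u
  end.

Let posT_inj : injective posT.
Proof.
have lt a b (p : point a b) : place p < a + b.
  by case: p => [[i ?]|[j ?]] /=; lia.
move=> [p|q] [p'|q'] /= H.
- by rewrite (place_inj H).
- by have := lt _ _ p; lia.
- by have := lt _ _ p'; lia.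
- by congr inr; apply: place_inj; lia.
Qed.

Let juxt_neq u : juxt u != u.
Proof.
by case: u => p /=; apply/eqP => -[] /eqP; rewrite (negPf (partner_neq _ _)).
Qed.

Let juxtK : involutive juxt.
Proof. by case=> p /=; rewrite partnerK. Qed.

Let planar (F : T -> T) := forall u v,
  posT u < posT v -> posT v < posT (F u) -> posT (F u) < posT (F v) -> False.

Let juxt_planar : planar juxt.
Proof.
have lt a b (p : point a b) : place p < a + b.
  by case: p => [[i ?]|[j ?]] /=; lia.
move=> [p|p] [q|q] /= H1 H2 H3.
- exact: (partner_nocross H1 H2 H3).
- by have := lt _ _ (x p); lia.
- by have := lt _ _ q; lia.
- by apply: (@partner_nocross _ _ y p q); lia.
Qed.

Let glue_sym k : symmetric (glue k).
Proof.
have E (u v : T) : (v == juxt u) = (u == juxt v).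
  by apply/eqP/eqP => ->; rewrite juxtK.
by move=> [[i|j]|[j|k']] [[i'|j']|[j'|k'']]; first [by [] | exact: E].
Qed.

Let joined k (F : T -> T) :=
  [/\ involutive F, planar F, (forall u, (F u == u) = gone k u) &
   forall u v, ~~ gone k u -> ~~ gone k v ->
     connect (glue k) u v = (v == u) || (v == F u)].


Let joined0 : joined 0 juxt.
Proof.
split=> [|||u v _ _].
- exact: juxtK.
- exact: juxt_planar.
- by move=> u; rewrite (negPf (juxt_neq u)); case: u => [[]|[]].
have E u' v' : glue 0 u' v' = (v' == juxt u').
  by case: u' v' => [[i|j]|[j|k']] [[i'|j']|[j'|k'']].
apply/idP/idP.
  have cl : closed (glue 0) [pred w | (w == u) || (w == juxt u)].
    apply: intro_closed => [|w w']; first exact/sym_connect_sym/glue_sym.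
    rewrite E !inE => /eqP-> /orP[]/eqP->; first by rewrite eqxx orbT.
    by rewrite juxtK eqxx.
  by move/(closed_connect cl); rewrite !inE eqxx /= => <-.
by case/orP=> /eqP->; rewrite ?connect0 //; apply: connect1; rewrite E.
Qed.

Let joinedS k F : k < m -> joined k F -> exists F1, joined k.+1 F1.
Proof.
move=> lt_km [FK Fpl Ffix Fcon].
pose o := Ordinal lt_km; pose a : T := inl (inr o); pose b : T := inr (inl o).
have goneS u : gone k.+1 u = [|| gone k u, u == a | u == b].
  case: u => [[i|j]|[j|i]] //=; rewrite -?[inl _ == inl _]/(_ == _) ltnS leq_eqVlt.
  - by rewrite orbC orbF.
  - by rewrite orbC.
have ngA : ~~ gone k a by rewrite /= ltnn.
have ngB : ~~ gone k b by rewrite /= ltnn.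
have nab : b != a by [].
have Finj := inv_inj FK.
pose F1 (u : T) : T := if (u == a) || (u == b) then u else
  if F u == a then F b else if F u == b then F a else F u.
have betw u : posT a < posT u -> posT u < posT b -> gone k u.
  case: u => [[[i Hi]|[j Hj]]|[[j Hj]|[i Hi]]] /=; lia.
have ab : posT a < posT b by rewrite /=; lia.
exists F1.
have F1a : F1 a = a by rewrite /F1 eqxx.
have F1b : F1 b = b by rewrite /F1 eqxx orbT.
have FA : F a != a by rewrite Ffix.
have FB : F b != b by rewrite Ffix.
have F1K : involutive F1.
  move=> u; rewrite [F1 u]/F1; case: ifP => [/orP[]/eqP->//|/negbT]; rewrite negb_or => /andP[ua ub].
  case: eqP => [Fua|Fua].
    have Eu : u = F a by rewrite -Fua FK.
    rewrite /F1 (negPf FB) FK (negPf nab) eqxx.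
    by rewrite -Fua (inj_eq Finj) eq_sym (negPf ub) /=.
  case: eqP => [Fub|Fub].
    have Eu : u = F b by rewrite -Fub FK.
    rewrite /F1 (negPf FA) FK eqxx.
    by rewrite -Fub (inj_eq Finj) eq_sym (negPf ua) /=.
  by rewrite /F1 !FK; do 2 case: eqP => //= _; rewrite (negPf ua) (negPf ub).
have F1fix u : (F1 u == u) = gone k.+1 u.
  rewrite goneS /F1; case: ifP => [|/negbT]; first by rewrite eqxx orbT.
  rewrite negb_or => /andP[ua ub].
  rewrite orbF -Ffix.
  have [Fua|_] := eqVneq (F u) a.
    apply/eqP/eqP => E; last by rewrite -E Fua eqxx in ua.
    by move: nab; rewrite -Fua -E FK eqxx.
  have [Fub|//] := eqVneq (F u) b.
  apply/eqP/eqP => E; last by rewrite -E Fub eqxx in ub.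
  by move: nab; rewrite -Fub -E FK eqxx.
have ngF w : ~~ gone k w -> ~~ gone k (F w).
  by rewrite -!Ffix (inj_eq Finj).
have ng w : ~~ gone k.+1 w -> [/\ ~~ gone k w, w != a & w != b].
  by rewrite goneS !negb_or => /and3P.
have out w : ~~ gone k w ->
    ~~ ((posT a < posT w) && (posT w < posT b)).
  by apply: contra => /andP[]; apply: betw.
have neq w w' : w != w' -> posT w != posT w'.
  by rewrite (inj_eq posT_inj).
have Fpl' w w' : ~~ [&& posT w < posT w', posT w' < posT (F w)
                     & posT (F w) < posT (F w')].
  by apply/negP => /and3P[]; apply: Fpl.
split=> //.
  move=> u v uv vu uv'.
  have [gu ua ub] : [/\ ~~ gone k u, u != a & u != b].
    by apply: ng; rewrite -F1fix; apply/eqP => E; rewrite E in vu; lia.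
  have [gv va vb] : [/\ ~~ gone k v, v != a & v != b].
    by apply: ng; rewrite -F1fix; apply/eqP => E; rewrite E in uv'; lia.
  have uNv : F u != F v by rewrite (inj_eq Finj); apply: contraTneq uv => ->; rewrite ltnn.
  move: vu uv'; rewrite /F1 (negPf ua) (negPf ub) (negPf va) (negPf vb) /=.
  have oFa := out _ (ngF _ ngA); have oFb := out _ (ngF _ ngB).
  have ou := out _ gu; have ov := out _ gv.
  have oFu := out _ (ngF _ gu); have oFv := out _ (ngF _ gv).
  have P0 := Fpl' u v.
  move/neq: ua => nua; move/neq: ub => nub.
  move/neq: va => nva; move/neq: vb => nvb.
  have [Fua|/neq nFua] := eqVneq (F u) a.
    have [Fva|/neq nFva] := eqVneq (F v) a; first by rewrite Fua Fva eqxx in uNv.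
    have [Fvb|/neq nFvb] := eqVneq (F v) b; first by rewrite -Fvb FK; lia.
    have P1 := Fpl' b v; have P2 := Fpl' v (F b).
    by rewrite FK in P2; rewrite Fua in P0; lia.
  have [Fub|/neq nFub] := eqVneq (F u) b.
    have [Fva|/neq nFva] := eqVneq (F v) a; first by rewrite -Fva FK; lia.
    have [Fvb|/neq nFvb] := eqVneq (F v) b; first by rewrite Fub Fvb eqxx in uNv.
    have P1 := Fpl' a v; have P2 := Fpl' v (F a).
    by rewrite FK in P2; rewrite Fub in P0; lia.
  have [Fva|/neq nFva] := eqVneq (F v) a.
    have P1 := Fpl' a u; have P2 := Fpl' u b.
    have Fa : F a = v by rewrite -Fva FK.
    by rewrite Fa in P1; rewrite Fva in P0; lia.
  have [Fvb|/neq nFvb] := eqVneq (F v) b; last by lia.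
  have P1 := Fpl' b u; have P2 := Fpl' u a.
  have Fb : F b = v by rewrite -Fvb FK.
  by rewrite Fb in P1; rewrite Fvb in P0; lia.
have glueS w w' : glue k.+1 w w' =
    [|| glue k w w', (w == a) && (w' == b) | (w == b) && (w' == a)].
  have eqo (j j' : 'I_m) : (j < k.+1) && (j == j') =
      (j < k) && (j == j') || ((j == o) && (j' == o)).
    rewrite ltnS leq_eqVlt orbC andb_orl; congr (_ || _).
    have -> : (nat_of_ord j == k) = (j == o) by [].
    by case: (j =P o) => //= ->; rewrite eq_sym.
  have Ea j : (inl (inr j) == a) = (j == o) by [].
  have Eb j : (inr (inl j) == b) = (j == o) by [].
  case: w w' => [[i|j]|[j|i]] [[i'|j']|[j'|i']] /=;
    rewrite ?andbF ?orbF ?Ea ?Eb ?eqo //.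
  by rewrite [(j == o) && _]andbC.
have subk w w' : connect (glue k) w w' -> connect (glue k.+1) w w'.
  apply: connect_sub => {}w {}w' H; apply: connect1; by rewrite glueS H.
have conF w : ~~ gone k w -> connect (glue k) w (F w).
  by move=> gw; rewrite Fcon ?eqxx ?orbT //; apply: ngF.
have conab : connect (glue k.+1) a b.
  by apply: connect1; rewrite glueS !eqxx orbT.
have consym := sym_connect_sym (glue_sym k.+1).
have consymk := sym_connect_sym (glue_sym k).
move=> u v gu gv.
have gF1 w : ~~ gone k.+1 w -> ~~ gone k.+1 (F1 w).
  by rewrite -!F1fix (inj_eq (inv_inj F1K)).
have F1con w : ~~ gone k.+1 w ->
    (connect (glue k) w a -> connect (glue k) (F1 w) b) /\
    (connect (glue k) w b -> connect (glue k) (F1 w) a).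
  move=> /ng[gw wa wb]; split; rewrite Fcon // eq_sym.
    rewrite (negPf wa) /= /F1 (negPf wa) (negPf wb) => /eqP <-.
    by rewrite eqxx consymk; apply: conF.
  rewrite (negPf wb) /= /F1 (negPf wa) (negPf wb) => /eqP <-.
  by rewrite (negPf nab) eqxx consymk; apply: conF.
apply/idP/idP.
  pose S := [pred w | connect (glue k) u w || connect (glue k) (F1 u) w].
  have clS : closed (glue k.+1) S.
    apply: intro_closed => // w w'; rewrite glueS !inE.
    have [ua ub] := F1con _ gu; have [u'a u'b] := F1con _ (gF1 _ gu).
    rewrite F1K in u'a u'b.
    case/or3P => [gww' /orP[] H|/andP[/eqP-> /eqP->]|/andP[/eqP-> /eqP->]].
    - by rewrite (connect_trans H (connect1 gww')).
    - by rewrite (connect_trans H (connect1 gww')) orbT.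
    - by case/orP=> [/ua|/u'a] ->; rewrite ?orbT.
    - by case/orP=> [/ub|/u'b] ->; rewrite ?orbT.
  move/(closed_connect clS); rewrite !inE connect0 /= => /esym.
  have [gu' ua ub] := ng _ gu; have [gv' va vb] := ng _ gv.
  have [gFu' _ _] := ng _ (gF1 _ gu).
  rewrite !Fcon // => /orP[] /orP[/eqP->|/eqP vE]; rewrite ?eqxx ?orbT //.
    by rewrite /F1 (negPf ua) (negPf ub) -vE (negPf va) (negPf vb) eqxx orbT.
  have := F1K u; have [_ Fua Fub] := ng _ (gF1 _ gu).
  by rewrite {1}/F1 (negPf Fua) (negPf Fub) -vE (negPf va) (negPf vb) /= => ->; rewrite eqxx.
have [gu' ua ub] := ng _ gu.
case/orP => /eqP->; first exact: connect0.
have cu := subk _ _ (conF _ gu').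
rewrite /F1 (negPf ua) (negPf ub) /=.
have [Fua|_] := eqVneq (F u) a.
  rewrite Fua in cu; apply: (connect_trans cu); apply: (connect_trans conab).
  exact/subk/conF.
have [Fub|_ //] := eqVneq (F u) b.
rewrite Fub in cu; apply: (connect_trans cu); rewrite consym in conab.
by apply: (connect_trans conab); apply/subk/conF.
Qed.

Lemma joined_exists : exists z : diagram n l, forall p q,
  connect (glued x y) (outer m p) (outer m q) = (q == p) || (q == z p).
Proof.
have [F [FK Fpl Ffix Fcon]] : exists F, joined m F.
  suff H k : k <= m -> exists F, joined k F by exact: H.
  elim: k => [_|k IH lt_km]; first by exists juxt; apply: joined0.
  by have [F HF] := IH (ltnW lt_km); apply: joinedS HF.
have ng (p : point n l) : ~~ gone m (outer m p) by case: p.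
pose z p : point n l := match F (outer m p) with
  | inl (inl i) => inl i | inr (inr k) => inr k | _ => p end.
have zE p : outer m (z p) = F (outer m p).
  have : ~~ gone m (F (outer m p)) by rewrite -Ffix (inj_eq (inv_inj FK)) Ffix ng.
  by rewrite /z; case: (F _) => [[i|j]|[j|i]] //=; rewrite ltn_ord.
have o_inj : injective (@outer n m l) by move=> [i|j] [i'|j'] //= [->].
have posE (p q : point n l) :
    (place p < place q) = (posT (outer m p) < posT (outer m q)).
  by case: p q => [[i Hi]|[i Hi]] [[j Hj]|[j Hj]] /=; lia.
have zpl : planar_pairing (finfun z).
  apply/and3P; split; apply/forallP => p; rewrite ?ffunE.
  - by rewrite -(inj_eq o_inj) zE Ffix; apply: ng.
  - by rewrite -(inj_eq o_inj) !zE FK.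
  apply/forallP => q; rewrite !ffunE !posE !zE; apply/negP => /and3P[].
  exact: Fpl.
exists (Diagram zpl) => p q; rewrite ffunE -!(inj_eq o_inj) zE -Fcon //.
apply: eq_connect => u v; case: u v => [[i|j]|[j|k']] [[i'|j']|[j'|k'']] //=.
- by rewrite ltn_ord.
- by rewrite ltn_ord.
Qed.

End Joins.

Section Assoc.

Lemma connect_img (C D : finType) (f : rel C) (f' : rel D) (g : C -> D) :
  (forall c c', f c c' -> connect f' (g c) (g c')) ->
  forall c c', connect f c c' -> connect f' (g c) (g c').
Proof.
move=> Hf c c' /connectP[s]; elim: s c => [|d s IH] c /= => [_ ->//|].
by case/andP=> /Hf H1 H2 H3; apply: connect_trans H1 (IH _ H2 H3).
Qed.

Lemma connect_transfer (A B : finType) (e : rel A) (e' : rel B)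
    (h : B -> A) (r : A -> B) :
  (forall b b', e' b b' -> connect e (h b) (h b')) ->
  (forall a a', e a a' -> connect e' (r a) (r a')) ->
  (forall b, connect e' b (r (h b))) -> connect_sym e' ->
  forall b b', connect e (h b) (h b') = connect e' b b'.
Proof.
move=> He' He Hr e'sym b b'; apply/idP/idP; last exact: connect_img.
move/(connect_img He) => H; apply: connect_trans (Hr b) _.
by apply: connect_trans H _; rewrite e'sym.
Qed.

Lemma connect_pairing n m (x : diagram n m) p q :
  connect [rel p q | q == x p] p q = (q == p) || (q == x p).
Proof.
apply/idP/idP; last first.
  by case/orP => /eqP->; [apply: connect0 | apply: connect1; rewrite /= eqxx].
move/connectP => [s]; elim: s p => [|d s IH] p /=; first by move=> _ ->; rewrite eqxx.
case/andP => /eqP-> /IH H /H; rewrite partnerK orbC => /orP[]->//.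
by rewrite orbT.
Qed.

Lemma glued_sym n m l (x : diagram n m) (y : diagram m l) :
  connect_sym (glued x y).
Proof.
apply: sym_connect_sym.
have E a b (z : diagram a b) p q : (p == z q) = (q == z p).
  by apply/eqP/eqP => ->; rewrite partnerK.
by move=> [[i|j]|[j|k']] [[i'|j']|[j'|k'']]; first [by [] | exact: E].
Qed.

Lemma is_concatP n m l (x : diagram n m) (y : diagram m l) (z : diagram n l) :
  reflect
    ((forall p q, connect (glued x y) (outer m p) (outer m q)
                    = (q == p) || (q == z p))
     /\ (forall u, exists p, connect (glued x y) u (outer m p)))
    (is_concat x y z).
Proof.
apply: (iffP andP) => -[H1 H2]; split.
- by move=> p q; apply/eqP; move/forallP/(_ p)/forallP: H1.
- by move=> u; apply/existsP; move/forallP: H2.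
- by apply/forallP => p; apply/forallP => q; apply/eqP.
- by apply/forallP => u; apply/existsP.
Qed.

Lemma diagram_eq n m (x y : diagram n m) : x =1 y -> x = y.
Proof. by move=> E; apply/val_inj/ffunP. Qed.

Lemma is_concat_uniq n m l (x : diagram n m) (y : diagram m l)
    (z z' : diagram n l) : is_concat x y z -> is_concat x y z' -> z = z'.
Proof.
move=> /is_concatP[H _] /is_concatP[H' _]; apply: diagram_eq => p.
have := H p (z p); rewrite H' eqxx orbT (negPf (partner_neq z p)) /=.
by move/eqP.
Qed.

Lemma concatE n m l (x : diagram n m) (y : diagram m l) (z : diagram n l) :
  (concat x y == Some z) = is_concat x y z.
Proof.
rewrite /concat; case: pickP => [z' Hz'|->] //.
apply/eqP/idP => [[<-]//|Hz]; congr Some; exact: is_concat_uniq Hz' Hz.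
Qed.

Variables (n m l k : nat) (x : diagram n m) (y : diagram m l) (w : diagram l k).

Let T := (point n m + point m l + point l k)%type.

Let glued3 : rel T := fun u v =>
  match u, v with
  | inl u, inl v => glued x y u v
  | inr p, inr q => q == w p
  | inl u, inr q | inr q, inl u =>
    match u, q with inr (inr i), inl i' => i == i' | _, _ => false end
  end.

Let outer3 (p : point n k) : T :=
  match p with inl i => inl (inl (inl i)) | inr j => inr (inr j) end.

Let triple (t : diagram n k) :=
  (forall p q, connect glued3 (outer3 p) (outer3 q) = (q == p) || (q == t p))
  /\ (forall u, exists p, connect glued3 u (outer3 p)).

Let sym3 : connect_sym glued3.
Proof.
apply: sym_connect_sym.
have E a b (z : diagram a b) p q : (p == z q) = (q == z p).
  by apply/eqP/eqP => ->; rewrite partnerK.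
by move=> [[[i|j]|[j|k1]]|[k1|k2]] [[[i'|j']|[j'|k1']]|[k1'|k2']];
  first [by [] | exact: E].
Qed.

Let concat_left z t : is_concat x y z -> (is_concat z w t <-> triple t).
Proof.
move=> /is_concatP[Hz loop].
pose h (b : point n l + point l k) : T :=
  match b with inl p => inl (outer m p) | inr q => inr q end.
have [rho Hrho] : exists rho, forall u, connect (glued x y) u (outer m (rho u)).
  exists (fun u => xchoose (loop u)) => u; exact: (xchooseP (loop u)).
pose r (a : T) : point n l + point l k :=
  match a with inl u => inl (rho u) | inr q => inr q end.
have liftl u v : connect (glued x y) u v -> connect glued3 (inl u) (inl v).
  apply: (@connect_img _ _ (glued x y) glued3 inl) => a a' H.
  exact: (@connect1 _ glued3 (inl a) (inl a') H).
have liftz p q : connect (glued x y) (outer m p) (outer m q) ->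
    connect (glued z w) (inl p) (inl q).
  by rewrite Hz => /orP[] /eqP->; [apply: connect0 | apply: connect1; rewrite /= eqxx].
have vhr v : connect glued3 v (h (r v)).
  by case: v => [u|q] /=; [apply: liftl | apply: connect0].
have hr b : connect (glued z w) b (r (h b)).
  by case: b => [p|q] /=; [apply: liftz | apply: connect0].
have zsym := glued_sym z w; have xysym := glued_sym x y.
have rG u u' : glued x y u u' ->
    connect (glued z w) (inl (rho u)) (inl (rho u')).
  move=> E; apply: liftz; apply: connect_trans (Hrho u').
  by rewrite xysym; apply: connect_trans (Hrho u); rewrite xysym connect1.
have key (i : 'I_l) :
    connect (glued z w) (inl (rho (inr (inr i)))) (inr (inl i)).
  apply: (@connect_trans _ _ (inl (inr i))).
    by apply: liftz; rewrite xysym; apply: (Hrho (inr (inr i))).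
  by apply: connect1; rewrite /= eqxx.
have tr b b' : connect glued3 (h b) (h b') = connect (glued z w) b b'.
  apply: (@connect_transfer _ _ _ _ h r) => // {b b'}.
    move=> [p|p] [q|q] /= E.
    - by apply: liftl; rewrite Hz E orbT.
    - by case: p q E => [i|j] [i'|j'] //= E; apply: connect1.
    - by case: p q E => [i|j] [i'|j'] //= E; apply: connect1.
    - exact: connect1.
  move=> [u|p] [v|q] /= E.
  - exact: rG.
  - by case: u E => [?|[?|i]] //; case: q => // i' /eqP <-; apply: key.
  - by case: v E => [?|[?|i]]; case: p => // i' /eqP <-; rewrite zsym; apply: key.
  - exact: connect1.
have hout p : h (outer l p) = outer3 p by case: p.
split.
  move/is_concatP=> [H1 H2]; split=> [p q|v]; first by rewrite -!hout tr H1.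
  have [p Hp] := H2 (r v); exists p; rewrite -hout.
  by apply: connect_trans (vhr v) _; rewrite tr.
move=> [H1 H2]; apply/is_concatP; split=> [p q|b].
  by rewrite -tr !hout H1.
by have [p Hp] := H2 (h b); exists p; rewrite -tr hout.
Qed.

Let concat_left_ex t : triple t -> exists z, is_concat x y z.
Proof.
move=> [_ loop]; have [z Hz] := joined_exists x y.
exists z; apply/is_concatP; split=> // u0.
have [p Hp] := loop (inl u0).
case: (boolP [exists p, connect (glued x y) u0 (outer m p)]) => [/existsP//|].
rewrite negb_exists => /forallP no.
pose S : pred T := fun v => if v is inl u then connect (glued x y) u0 u else false.
have cl : closed glued3 S.
  apply: intro_closed => // -[u|q] [v|q'] // E; rewrite !unfold_in /= => H.
    exact: connect_trans H (connect1 (E : glued x y u v)).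
  by case: u E H => [?|[?|i]] //= _ H; have := no (inr i); rewrite H.
move/(closed_connect cl): Hp; rewrite !unfold_in /= connect0 => /esym.
by case: p => // i /= H; have := no (inl i); rewrite H.
Qed.

Let concat_right v t : is_concat y w v -> (is_concat x v t <-> triple t).
Proof.
move=> /is_concatP[Hv loop].
pose g (u : point m l + point l k) : T :=
  match u with inl p => inl (inr p) | inr q => inr q end.
pose h (b : point n m + point m k) : T :=
  match b with inl p => inl (inl p) | inr q => g (outer l q) end.
have [rho Hrho] : exists rho, forall u, connect (glued y w) u (outer l (rho u)).
  exists (fun u => xchoose (loop u)) => u; exact: (xchooseP (loop u)).
pose r (a : T) : point n m + point m k :=
  match a with inl (inl p) => inl p
             | inl (inr p) => inr (rho (inl p)) | inr q => inr (rho (inr q)) end.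
have liftr u u' : connect (glued y w) u u' -> connect glued3 (g u) (g u').
  by apply: (@connect_img _ _ (glued y w) glued3 g) => -[[?|?]|[?|?]] [[?|?]|[?|?]] H; apply: connect1.
have liftv p q : connect (glued y w) (outer l p) (outer l q) ->
    connect (glued x v) (inr p) (inr q).
  by rewrite Hv => /orP[] /eqP->; [apply: connect0 | apply: connect1; rewrite /= eqxx].
have rg u : r (g u) = inr (rho u) by case: u.
have vhr a : connect glued3 a (h (r a)).
  by case: a => [[p|p]|p] /=; [apply: connect0 | apply: (liftr (inl p))
                              | apply: (liftr (inr p))].
have hr b : connect (glued x v) b (r (h b)).
  by case: b => [p|q] /=; [apply: connect0 | rewrite rg; apply: liftv].
have zsym := glued_sym x v; have ywsym := glued_sym y w.
have rG u u' : glued y w u u' ->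
    connect (glued x v) (inr (rho u)) (inr (rho u')).
  move=> E; apply: liftv; apply: connect_trans (Hrho u').
  by rewrite ywsym; apply: connect_trans (Hrho u); rewrite ywsym connect1.
have key (i : 'I_m) :
    connect (glued x v) (inl (inr i)) (inr (rho (inl (inl i)))).
  apply: (@connect_trans _ _ (inr (inl i))); first by apply: connect1; rewrite /= eqxx.
  by apply: liftv; apply: (Hrho (inl (inl i))).
have tr b b' : connect glued3 (h b) (h b') = connect (glued x v) b b'.
  apply: (@connect_transfer _ _ _ _ h r) => // {b b'}.
    move=> [p|p] [q|q] /= E.
    - exact: connect1.
    - by case: p q E => [i|j] [i'|j'] //= E; apply: connect1.
    - by case: p q E => [i|j] [i'|j'] //= E; apply: connect1.
    - by apply: liftr; rewrite Hv E orbT.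
  move=> [[p|p]|p] [[q|q]|q] /= E.
  - exact: connect1.
  - by case: p q E => [i|j] [i'|j'] //= /eqP<-; apply: key.
  - by [].
  - by case: p q E => [i|j] [i'|j'] //= /eqP<-; rewrite zsym; apply: key.
  - exact: (rG (inl p) (inl q)).
  - by apply: (rG (inl p) (inr q)); case: p q E => [i|j] [i'|j'].
  - by case: p E.
  - by apply: (rG (inr p) (inl q)); case: p q E => [i|j] [i'|j'].
  - exact: (rG (inr p) (inr q)).
have hout p : h (outer m p) = outer3 p by case: p.
split.
  move/is_concatP=> [H1 H2]; split=> [p q|a]; first by rewrite -!hout tr H1.
  have [p Hp] := H2 (r a); exists p; rewrite -hout.
  by apply: connect_trans (vhr a) _; rewrite tr.
move=> [H1 H2]; apply/is_concatP; split=> [p q|b].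
  by rewrite -tr !hout H1.
by have [p Hp] := H2 (h b); exists p; rewrite -tr hout.
Qed.

Let concat_right_ex t : triple t -> exists v, is_concat y w v.
Proof.
move=> [_ loop]; have [v Hv] := joined_exists y w.
exists v; apply/is_concatP; split=> // u0.
pose g (u : point m l + point l k) : T :=
  match u with inl p => inl (inr p) | inr q => inr q end.
have [p Hp] := loop (g u0).
case: (boolP [exists p, connect (glued y w) u0 (outer l p)]) => [/existsP//|].
rewrite negb_exists => /forallP no.
pose S : pred T := fun a => match a with
  | inl (inr p) => connect (glued y w) u0 (inl p)
  | inr q => connect (glued y w) u0 (inr q) | _ => false end.
have Sg u : S (g u) = connect (glued y w) u0 u by case: u.
have cl : closed glued3 S.
  apply: intro_closed => // -[[p1|p1]|p1] [[q|q]|q] // E; rewrite !unfold_in /= => H.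
  - by case: p1 q E H => [i|j] [i'|j'] //= _ H; have := no (inl i); rewrite H.
  - exact: connect_trans H (connect1 (E : glued y w (inl _) (inl _))).
  - by apply: (connect_trans H); apply: connect1; case: p1 q E {H} => [i|j] [i'|j'].
  - by apply: (connect_trans H); apply: connect1; case: p1 q E {H} => [i|j] [i'|j'].
  - exact: connect_trans H (connect1 (E : glued y w (inr _) (inr _))).
move/(closed_connect cl): Hp; rewrite -![_ \in S]/(S _) Sg connect0 => /esym.
by case: p => // i /= H; have := no (inr i); rewrite H.
Qed.

Lemma concatA : obind (fun z => concat z w) (concat x y) =
                obind (fun v => concat x v) (concat y w).
Proof.
have L t : obind (fun z => concat z w) (concat x y) = Some t <-> triple t.
  split=> [|Ht].
    case E: (concat x y) => [z|] //= /eqP.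
    by rewrite concatE => /concat_left; apply; rewrite -concatE E.
  have [z Hz] := concat_left_ex Ht.
  have /eqP-> : concat x y == Some z by rewrite concatE.
  by apply/eqP; rewrite /= concatE; apply/(concat_left _ Hz).
have R t : obind (fun v => concat x v) (concat y w) = Some t <-> triple t.
  split=> [|Ht].
    case E: (concat y w) => [v|] //= /eqP.
    by rewrite concatE => /concat_right; apply; rewrite -concatE E.
  have [v Hv] := concat_right_ex Ht.
  have /eqP-> : concat y w == Some v by rewrite concatE.
  by apply/eqP; rewrite /= concatE; apply/(concat_right _ Hv).
case E: (obind _ _) => [t|]; first by apply/esym/R/L.
by case E': (obind _ _) => [t|] //; move: E' => /R/L; rewrite E.
Qed.

End Assoc.

Section Identity.
Variable n : nat.

Definition id_pairing : {ffun point n n -> point n n} :=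
  [ffun p => match p with inl i => inr i | inr i => inl i end].

Lemma id_planar : planar_pairing id_pairing.
Proof.
apply/and3P; split; apply/forallP => p; rewrite ?ffunE.
- by case: p.
- by case: p.
apply/forallP => q; rewrite !ffunE.
by case: p q => [[i Hi]|[i Hi]] [[j Hj]|[j Hj]] /=; lia.
Qed.

Definition id_diagram : diagram n n := Diagram id_planar.

End Identity.

Lemma is_concat_diagram n m l (x : diagram n m) (y : diagram m l)
    (t : diagram n l) (r : point n m + point m l -> point n l) :
  (forall p, r (outer m p) = p) ->
  (forall u, connect (glued x y) u (outer m (r u))) ->
  (forall u v, glued x y u v -> (r v == r u) || (r v == t (r u))) ->
  (forall p, connect (glued x y) (outer m p) (outer m (t p))) ->
  is_concat x y t.
Proof.
move=> ro Hr He Ht; apply/is_concatP; split; last by move=> u; exists (r u).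
move=> p q; rewrite -(connect_pairing t).
apply: (@connect_transfer _ _ _ _ (@outer n m l) r) => //.
- by move=> b b' /= /eqP->.
- move=> u v /He /orP[] /eqP-> //; apply: connect1; exact: eqxx.
- by move=> b; rewrite ro.
apply: sym_connect_sym => b b' /=.
by apply/eqP/eqP => ->; rewrite partnerK.
Qed.

Lemma concat_id_left n m (x : diagram n m) : concat (id_diagram n) x = Some x.
Proof.
pose r (u : point n n + point n m) : point n m := match u with
  | inl (inl i) | inl (inr i) => inl i | inr p => p end.
pose o := @outer n n m.
have c0 p : connect (glued (id_diagram n) x) (inr p) (o p).
  case: p => [i|j] //.
  apply: (@connect_trans _ _ (inl (inr i))); apply: connect1 => //=.
  by rewrite ffunE.
apply/eqP; rewrite concatE; apply: (@is_concat_diagram _ _ _ _ _ _ r).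
- by case.
- case=> [[i|i]|p] //.
  by apply: connect1; rewrite /= ffunE.
- move=> [[i|i]|p] [[j|j]|q] //=; rewrite ?ffunE //.
  + by move/eqP=> [->]; rewrite eqxx.
  + by move/eqP=> [->]; rewrite eqxx.
  + by case: q => // j /eqP->; rewrite eqxx.
  + by case: p => // i /eqP->; rewrite eqxx.
  + by move=> ->; rewrite orbT.
move=> p; apply: (@connect_trans _ _ (inr p)); first by rewrite glued_sym; apply: c0.
apply: connect_trans (c0 (x p)); apply: connect1; exact: eqxx.
Qed.

Lemma concat_id_right n m (x : diagram n m) : concat x (id_diagram m) = Some x.
Proof.
pose r (u : point n m + point m m) : point n m := match u with
  | inl p => p | inr (inl j) | inr (inr j) => inr j end.
pose o := @outer n m m.
have c0 p : connect (glued x (id_diagram m)) (inl p) (o p).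
  case: p => [i|j] //.
  by apply: (@connect_trans _ _ (inr (inl j))); apply: connect1; rewrite /= ?ffunE.
apply/eqP; rewrite concatE; apply: (@is_concat_diagram _ _ _ _ _ _ r).
- by case.
- case=> [p|[i|i]] //.
  by apply: connect1; rewrite /= ffunE.
- move=> [p|[i|i]] [q|[j|j]] //=; rewrite ?ffunE //.
  + by move=> ->; rewrite orbT.
  + by case: p => // i /eqP->; rewrite eqxx.
  + by case: p.
  + by case: q => // j /eqP->; rewrite eqxx.
  + by move/eqP=> [->]; rewrite eqxx.
  + by case: q.
  + by move/eqP=> [->]; rewrite eqxx.
move=> p; apply: (@connect_trans _ _ (inl p)); first by rewrite glued_sym; apply: c0.
apply: connect_trans (c0 (x p)); apply: connect1; exact: eqxx.
Qed.

(* No curve joins two bottom points. *)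
Definition monic n m (x : diagram n m) : bool :=
  [forall j : 'I_m, if x (inr j) is inl _ then true else false].

Lemma concat_monic n m l (x : diagram n m) (y : diagram m l) (z : diagram n l) :
  concat x y = Some z -> monic z -> monic y.
Proof.
move/eqP; rewrite concatE => /is_concatP[H _] /forallP mz.
apply/forallP => j; case E: (y (inr j)) => [//|j'].
have := H (inr j) (inr j'); rewrite (connect1 (_ : glued x y _ _)); last first.
  by rewrite /= E.
case/esym/orP => /eqP E'; last by have := mz j; rewrite -E'.
by case: E' => E'; move: (partner_neq y (inr j)); rewrite E E' eqxx.
Qed.

(* The diagram joining the (i+1)th and (i+2)th of the l + 2 top points, the
   other top points being joined vertically to the l bottom points in order:
   [lift i0 (lift i k)] is the top point k if k < i and k + 2 otherwise. *)
Section Delta.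
Variables (l : nat) (i : 'I_l.+1).
Let i0 : 'I_l.+2 := widen_ord (leqnSn l.+1) i.
Let i1 : 'I_l.+2 := lift ord0 i.

Definition delta_pairing : {ffun point l.+2 l -> point l.+2 l} :=
  [ffun p => match p with
   | inl j => if obind (unlift i) (unlift i0 j) is Some k then inr k
              else inl (if j == i0 then i1 else i0)
   | inr k => inl (lift i0 (lift i k))
   end].

Let i1E : i1 = lift i0 i.
Proof. by apply: val_inj; rewrite /= /bump leqnn leq0n. Qed.

Let deltaP p : p = inl i0 \/ p = inl i1 \/
  exists k, p = inl (lift i0 (lift i k)) \/ p = inr k.
Proof.
case: p => [j|k]; last by right; right; exists k; right.
case: (unliftP i0 j) => [j' ->|->]; last by left.
case: (unliftP i j') => [k ->|->]; last by right; left; rewrite i1E.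
by right; right; exists k; left.
Qed.

Let d0 : delta_pairing (inl i0) = inl i1.
Proof. by rewrite ffunE unlift_none eqxx. Qed.

Let d1 : delta_pairing (inl i1) = inl i0.
Proof.
by rewrite ffunE i1E liftK /= unlift_none [_ == i0]eq_sym (negPf (neq_lift _ _)).
Qed.

Let dl k : delta_pairing (inl (lift i0 (lift i k))) = inr k.
Proof. by rewrite ffunE !liftK /= liftK. Qed.

Let dr k : delta_pairing (inr k) = inl (lift i0 (lift i k)).
Proof. by rewrite ffunE. Qed.

Lemma delta_planar : planar_pairing delta_pairing.
Proof.
have vl k : lift i0 (lift i k) = (if k < i then k : nat else k.+2) :> nat.
  by rewrite /= /bump; case: ltnP => H; lia.
have v1 : i1 = i.+1 :> nat by [].
have v0 : i0 = i :> nat by [].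
apply/and3P; split; apply/forallP => p.
- case: (deltaP p) => [->|[->|[k [] ->]]]; rewrite ?d0 ?d1 ?dl ?dr //.
  + by apply/eqP => /(congr1 (@place _ _)); rewrite /= /bump; lia.
  + by apply/eqP => /(congr1 (@place _ _)); rewrite /= /bump; lia.
- by case: (deltaP p) => [->|[->|[k [] ->]]]; rewrite ?(d0, d1, dl, dr).
apply/forallP => q.
case: (deltaP p) => [->|[->|[k [] ->]]]; case: (deltaP q) => [->|[->|[k' [] ->]]];
  rewrite ?(d0, d1, dl, dr) /place ?vl ?v1 ?v0;
  have := ltn_ord i; try case: k => k ?; try case: k' => k' ?; rewrite /=;
  try (case: (ltnP k i)); try (case: (ltnP k' i)); lia.
Qed.

Definition delta : diagram l.+2 l := Diagram delta_planar.

End Delta.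

Local Open Scope ring_scope.

(* The linear map sending each basis element d of {ffun D -> F} to G d. *)
Definition extend (F : fieldType) (V : lmodType F) (D : finType) (G : D -> V)
    (f : {ffun D -> F^o}) : V := \sum_d f d *: G d.

Section Extend.
Variables (F : fieldType) (V : lmodType F) (D : finType).
Implicit Types (G : D -> V) (f g : {ffun D -> F^o}).

Lemma extend_is_linear G : linear (extend G).
Proof.
move=> c f g; rewrite /extend scaler_sumr -big_split; apply: eq_bigr => d _ /=.
by rewrite !ffunE scalerDl scalerA.
Qed.

HB.instance Definition _ G :=
  GRing.isLinear.Build F {ffun D -> F^o} V *:%R (extend G) (extend_is_linear G).

Lemma extendZ G c f : extend G (c *: f) = c *: extend G f.
Proof. exact: linearZ. Qed.

Lemma eq_extend G G' f : G =1 G' -> extend G f = extend G' f.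
Proof. by move=> E; apply: eq_bigr => d _; rewrite E. Qed.

Lemma linear_extend (U : lmodType F) (h : {linear V -> U}) G f :
  h (extend G f) = extend (h \o G) f.
Proof. by rewrite linear_sum; apply: eq_bigr => d _; rewrite linearZ. Qed.

Lemma extend_basis G (b : {ffun D -> F^o}) d :
  (forall d', b d' = (d == d')%:R) -> extend G b = G d.
Proof.
move=> Hb; rewrite /extend (bigD1 d) //= Hb eqxx scale1r big1 ?addr0 // => d' nd.
by rewrite Hb eq_sym (negPf nd) scale0r.
Qed.

Lemma extend_zero (f : {ffun D -> F^o}) : extend (fun _ => 0 : V) f = 0.
Proof. by apply: big1 => d _; rewrite scaler0. Qed.

End Extend.

(* TL_n(0), as the free vector space on the planar diagrams, with the product
   extending [concat] bilinearly. *)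
Definition TL (F : fieldType) (n : nat) : Type := {ffun diagram n n -> F^o}.

HB.instance Definition _ F n :=
  GRing.Lmodule.copy (TL F n) {ffun diagram n n -> F^o}.

Section TLAlgebra.
Variables (F : fieldType) (n : nat).
Implicit Types a b c : TL F n.

Definition TL_basis (o : option (diagram n n)) : TL F n :=
  [ffun z => (o == Some z)%:R].

Definition TL_one : TL F n := TL_basis (Some (id_diagram n)).

Definition TL_mul a b : TL F n :=
  extend (fun x => extend (fun y => TL_basis (concat x y)) b) a.

Let basis0 : TL_basis None = 0.
Proof. by apply/ffunP => z; rewrite !ffunE. Qed.

Let extendB (V : lmodType F) (G : diagram n n -> V) o :
  extend G (TL_basis o) = oapp G 0 o.
Proof.
case: o => [x|] /=; last by rewrite basis0 linear0.
by apply: extend_basis => y; rewrite ffunE.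
Qed.

Let extend_id a : extend (fun x => TL_basis (Some x)) a = a.
Proof.
apply/ffunP => z; rewrite /extend sum_ffunE (bigD1 z) //= !ffunE eqxx.
rewrite big1 ?addr0 => [|x nx]; first exact: mulr1.
by rewrite !ffunE (inj_eq Some_inj) (negPf nx); apply: mulr0.
Qed.

Lemma TL_mulA : associative TL_mul.
Proof.
move=> a b c; rewrite /TL_mul linear_extend; apply: eq_extend => x /=.
rewrite !linear_extend; apply: eq_extend => y /=.
rewrite extendB linear_extend.
transitivity (extend (fun w => TL_basis (obind (fun z => concat z w) (concat x y))) c);
  last first.
  case: (concat x y) => //=; rewrite basis0; exact: extend_zero.
apply: eq_extend => w /=; rewrite concatA extendB.
by case: (concat y w) => [v|] //=; rewrite basis0.
Qed.

Lemma TL_mul1 : left_id TL_one TL_mul.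
Proof.
move=> a; rewrite /TL_mul /TL_one extendB /= -[RHS]extend_id.
by apply: eq_extend => x; rewrite concat_id_left.
Qed.

Lemma TL_mulr1 : right_id TL_one TL_mul.
Proof.
move=> a; rewrite -[RHS]extend_id; apply: eq_extend => x.
by rewrite /TL_one extendB /= concat_id_right.
Qed.

Lemma TL_mulDl : left_distributive TL_mul +%R.
Proof. by move=> a b c; rewrite /TL_mul linearD. Qed.

Lemma TL_mulDr : right_distributive TL_mul +%R.
Proof.
move=> a b c; rewrite /TL_mul /extend -big_split; apply: eq_bigr => x _ /=.
by rewrite -scalerDr -[X in _ *: X = _]/(extend _ (b + c)) linearD.
Qed.

Lemma TL_one_neq0 : TL_one != 0.
Proof.
apply/eqP => /ffunP/(_ (id_diagram n)); rewrite !ffunE eqxx.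
by apply/eqP; rewrite oner_eq0.
Qed.

HB.instance Definition _ := GRing.Zmodule_isNzRing.Build (TL F n)
  TL_mulA TL_mul1 TL_mulr1 TL_mulDl TL_mulDr TL_one_neq0.

Lemma TL_scaleAl (k : F) a b : k *: (a * b) = (k *: a) * b.
Proof. by apply/esym; apply: extendZ. Qed.

HB.instance Definition _ := GRing.Lmodule_isLalgebra.Build F (TL F n) TL_scaleAl.

Lemma TL_scaleAr (k : F) a b : k *: (a * b) = a * (k *: b).
Proof.
transitivity (extend (fun x =>
  k *: extend (fun y => TL_basis (concat x y)) b) a : TL F n).
  by rewrite /extend scaler_sumr; apply: eq_bigr => x _; rewrite !scalerA mulrC.
by apply: eq_extend => x; rewrite -extendZ.
Qed.

HB.instance Definition _ := GRing.Lalgebra_isAlgebra.Build F (TL F n) TL_scaleAr.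

End TLAlgebra.

Definition monic_diagram n l := {x : diagram n l | monic x}.

(* W_l^n.  Its canonical module structure is the one over TL F n below; that over
   F is the one of the underlying {ffun _ -> F^o}. *)
Definition W (F : fieldType) (n l : nat) : Type :=
  {ffun monic_diagram n l -> F^o}.

HB.instance Definition _ F n l :=
  GRing.Zmodule.copy (W F n l) {ffun monic_diagram n l -> F^o}.

Section Standard.
Variables (F : fieldType) (n l : nat).

(* The basis element given by a diagram; it is 0 for diagrams with a cap. *)
Definition W_basis (o : option (diagram n l)) :
    {ffun monic_diagram n l -> F^o} := [ffun z => (o == Some (val z))%:R].

Definition W_act (a : TL F n) (w : W F n l) : W F n l :=
  extend (fun d => extend (fun x : monic_diagram n l =>
    W_basis (concat d (val x))) w) a.

Let basis0 : W_basis None = 0.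
Proof. by apply/ffunP => z; rewrite !ffunE. Qed.

Let extendB d o :
  extend (fun x : monic_diagram n l => W_basis (concat d (val x))) (W_basis o)
  = W_basis (obind (fun z : diagram n l => concat d z) o).
Proof.
case: o => [z|] /=; last by rewrite basis0 linear0.
case: (boolP (monic z)) => mz.
  rewrite (@extend_basis _ _ _ _ _ (exist _ z mz)) // => x.
  by rewrite ffunE -val_eqE.
have -> : W_basis (Some z) = 0.
  apply/ffunP => x; rewrite !ffunE (inj_eq Some_inj).
  by case: eqP => // E; move: mz; rewrite E (valP x).
rewrite linear0; apply/ffunP => x; rewrite !ffunE.
by case: eqP => // /concat_monic H; move: mz; rewrite H // (valP x).
Qed.

Let extend_id (w : {ffun monic_diagram n l -> F^o}) :
  extend (fun x : monic_diagram n l => W_basis (Some (val x))) w = w.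
Proof.
apply/ffunP => z; rewrite /extend sum_ffunE (bigD1 z) //= !ffunE eqxx.
rewrite big1 ?addr0 => [|x nx]; first exact: mulr1.
by rewrite !ffunE (inj_eq Some_inj) val_eqE (negPf nx); apply: mulr0.
Qed.

Lemma W_actA a b w : W_act a (W_act b w) = W_act (a * b) w.
Proof.
rewrite -[a * b]/(TL_mul a b) /W_act /TL_mul.
rewrite [RHS]linear_extend; apply: eq_extend => d /=.
rewrite !linear_extend; apply: eq_extend => e /=.
transitivity (extend (fun x : monic_diagram n l => W_basis
    (obind (fun z => concat z (val x)) (concat d e))) w); last first.
  case: (concat d e) => [z|] /=; last first.
    rewrite basis0 extend_zero; apply/esym; rewrite (_ : TL_basis F None = 0).
      exact: linear0.
    by apply/ffunP => z; rewrite !ffunE.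
  by rewrite (@extend_basis _ _ _ _ _ z) // => x; rewrite ffunE.
rewrite linear_extend; apply: eq_extend => x /=.
by rewrite concatA extendB.
Qed.

Lemma W_act1 : left_id 1 W_act.
Proof.
move=> w; rewrite /W_act (@extend_basis _ _ _ _ _ (id_diagram n)) => [|x].
  by rewrite -[RHS]extend_id; apply: eq_extend => x; rewrite concat_id_left.
by rewrite ffunE.
Qed.

Lemma W_actDr : right_distributive W_act +%R.
Proof.
move=> a v w; rewrite /W_act /extend -big_split; apply: eq_bigr => x _ /=.
by rewrite -scalerDr -[X in _ *: X = _]/(extend _ (v + w)) linearD.
Qed.

Lemma W_actDl w : {morph W_act^~ w : a b / a + b}.
Proof. by move=> a b; rewrite /W_act linearD. Qed.

HB.instance Definition _ := GRing.Zmodule_isLmodule.Build (TL F n) (W F n l)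
  W_actA W_act1 W_actDr W_actDl.

End Standard.

(* x delta_i^l is the concatenation of x and [delta i]; since i <= l./2, inord
   only casts i.*2 to 'I_l.+1. *)
Definition phi (F : fieldType) (n l : nat) : W F n l.+2 -> W F n l :=
  extend (fun x : monic_diagram n l.+2 =>
    \sum_(i < l./2.+1) (-1) ^+ i *: W_basis F (concat (val x) (delta (inord i.*2)))).

Section Modules.
Variable A : nzRingType.

Definition isomorphic_modules (U V : lmodType A) : Prop :=
  exists g : {linear U -> V}, bijective g.

Definition irreducible_module (V : lmodType A) : Prop :=
  (exists v : V, v != 0) /\
  forall S : {pred V}, submod_closed S ->
    (forall v, v \in S -> v = 0) \/ (forall v, v \in S).

Section Image.
Variables (U V : lmodType A) (f : {linear U -> V}).

Definition in_image : {pred V} := fun v => `[< exists u, f u = v >].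

Lemma in_image_submod : submod_closed in_image.
Proof.
split=> [|a v w]; rewrite !unfold_in; first by apply/asboolP; exists 0; rewrite linear0.
move=> /asboolP[u <-] /asboolP[u' <-]; apply/asboolP.
by exists (a *: u + u'); rewrite linearP.
Qed.

HB.instance Definition _ := GRing.isSubmodClosed.Build A V in_image in_image_submod.

Record image_module := ImageModule {
  image_val : V;
  image_valP : in_image image_val }.

HB.instance Definition _ := [isSub for image_val].
HB.instance Definition _ := [Choice of image_module by <:].
HB.instance Definition _ := [SubChoice_isSubLmodule of image_module by <:].

End Image.
End Modules.

(* Main.v *)
(* Write W_l for W_l^n, F for the field, and delta_i, gamma_i for the diagrams with
   a single cup, resp. a single cap.

   The maps phi kill the diagrams with a cap: such a diagram factors as x gamma_j,
   and in x gamma_j phi the two terms delta_(j-1), delta_(j+1) cancel while the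
   others still have a cap or a loop; hence phi commutes with the action.
   phi phi = 0 is the simplicial identity delta_i delta_j = delta_(j+2) delta_i.
   Bending the last throughline up to the right gives a bijection from the monic
   diagrams n -> l + 2 whose last top point is on a throughline to the monic
   diagrams n -> l whose last top point is on a cup.  With respect to it phi is
   triangular with diagonal +1 or -1, which makes the complex exact.

   If some diagram d : l + 2 -> n maps v in W_(l+2) to a nonzero vector, which is
   then a multiple of the identity diagram, the products x d show that v generates
   W_(l+2).  Otherwise phi v is killed by all diagrams l + 2 -> n, and an induction
   on n shows phi v = 0: it suffices that no nonzero vector of W_l is killed by all
   caps when n >= l + 4.  Splitting W_l according to the last top point reduces this
   to l odd and n = l + 2 or n = l + 4, where the equations on the coefficients
   force (l + 3) / 2 times one of them, hence all, to vanish.  So every vector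
   outside ker phi generates W_(l+2), and im phi is irreducible.

   The diagrams through j < l + 2 strands kill im phi, and those through l + 2
   strands do not, so the images are pairwise non-isomorphic.  If V is irreducible,
   let k be least such that some product x d through k strands acts on V by a
   nonzero map, say x d v <> 0.  Then y |-> (y d) v is a surjection from W_k to V,
   and its kernel is that of phi; when k = 0, one composes it with phi_0. *)

From HB Require Import structures.
From mathcomp Require Import all_boot all_order all_algebra zify.
From mathcomp Require Import boolp reals complex.
Require Import Defs.

Set Implicit Arguments.
Unset Strict Implicit.
Unset Printing Implicit Defensive.

Import GRing.Theory.

(* The code of a point does not depend on the numbers of points, so that diagrams
   of different sizes can be compared. *)
Definition code n m (p : point n m) : int :=
  match p with inl i => i%:Z | inr j => - j%:Z - 1 end%R.

Lemma code_inj n m : injective (@code n m).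
Proof.
by move=> [i|j] [i'|j'] /= H; try (exfalso; lia); congr (_ _); apply/val_inj => /=; lia.
Qed.

Lemma code_bounds n m (p : point n m) : (- m%:Z <= code p < n%:Z)%R.
Proof. by case: p => -[i Hi] /=; lia. Qed.

Lemma place_code n m (p : point n m) :
  ((place p)%:Z = if 0 <= code p then code p else code p + n%:Z + m%:Z)%R.
Proof. by case: ifP; case: p => -[i Hi] /=; lia. Qed.

Lemma code_surj n m (c : int) : (- m%:Z <= c < n%:Z)%R ->
  exists p : point n m, code p = c.
Proof.
case: c => c Hc.
  have H : c < n by lia.
  by exists (inl (Ordinal H)).
have H : c < m by lia.
by exists (inr (Ordinal H)) => /=; lia.
Qed.

Lemma diagram_eq_code n m (x y : diagram n m) :
  (forall p, code (x p) = code (y p)) -> x = y.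
Proof. by move=> H; apply: diagram_eq => p; apply: code_inj. Qed.

(** * Planar pairings *)

Section Insertion.
Variables (n m n' m' : nat) (e : point n m -> point n' m') (s t : point n' m').
Hypothesis e_lt : forall p q, (place (e p) < place (e q)) = (place p < place q).
Hypothesis e_cover : forall q, [\/ q = s, q = t | exists p, q = e p].
Hypothesis e_s : forall p, e p != s.
Hypothesis e_t : forall p, e p != t.
Lemma insertion_inj : injective e.
Proof.
move=> p q E; apply: place_inj; have := e_lt p q; have := e_lt q p.
by rewrite E ltnn; lia.
Qed.

(** Deleting a whole curve creates no crossing, and [e] respects the order round the boundary. *)
Lemma remove_pair (z : diagram n' m') : z s = t ->
  exists x : diagram n m, forall p, e (x p) = z (e p).
Proof.
move=> zs; have zt : z t = s by rewrite -zs partnerK.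
pose f p := odflt p [pick q | e q == z (e p)].
have fe p : e (f p) = z (e p).
  rewrite /f; case: pickP => [q /eqP //|none] /=.
  case: (e_cover (z (e p))) => [E|E|[q E]].
  - by have := e_t p; rewrite -(partnerK z (e p)) E zs eqxx.
  - by have := e_s p; rewrite -(partnerK z (e p)) E zt eqxx.
  - by have := none q; rewrite E eqxx.
suff pl : planar_pairing (finfun f).
  by exists (Diagram pl) => p; rewrite ffunE.
apply/and3P; split; apply/forallP => p; rewrite ?ffunE.
- by rewrite -(inj_eq insertion_inj) fe partner_neq.
- by rewrite -(inj_eq insertion_inj) !fe partnerK.
apply/forallP => q; rewrite !ffunE -!e_lt !fe; apply/negP => /and3P[].
exact: partner_nocross.
Qed.

Hypothesis st : place t = (place s).+1.

(** A curve joining neighbouring places cannot be crossed. The diagram is returned in [Type], so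
    that [tens] can be extracted from it. *)
Lemma insert_pair (x : diagram n m) :
  {z : diagram n' m' | z s = t & forall p, z (e p) = e (x p)}.
Proof.
(* By [e_cover] every point other than [s] and [t] is some [e p], so the default [q] is never
   reached. *)
pose f q := if q == s then t else if q == t then s else
  if [pick p | e p == q] is Some p then e (x p) else q.
have nst : t != s by apply/eqP => E; move: st; rewrite E; lia.
have fs : f s = t by rewrite /f eqxx.
have ft : f t = s by rewrite /f eqxx (negPf nst).
have fe p : f (e p) = e (x p).
  rewrite /f (negPf (e_s p)) (negPf (e_t p)); case: pickP => [p' /eqP/insertion_inj->//|].
  by move/(_ p); rewrite eqxx.
suff pl : planar_pairing (finfun f).
  by exists (Diagram pl) => [|p]; rewrite ffunE.
apply/and3P; split; apply/forallP => q; rewrite ?ffunE.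
- case: (e_cover q) => [->|->|[p ->]]; rewrite ?(fs, ft, fe) //; first by rewrite eq_sym.
  by rewrite (inj_eq insertion_inj) partner_neq.
- by case: (e_cover q) => [->|->|[p ->]]; rewrite ?(fs, ft, fe) // partnerK.
apply/forallP => q'; rewrite !ffunE; apply/negP => /and3P[].
case: (e_cover q) => [->|->|[p ->]]; case: (e_cover q') => [->|->|[p' ->]];
  rewrite ?(fs, ft, fe); try lia.
  rewrite !e_lt; exact: partner_nocross.
Qed.

End Insertion.

(** * Reflection of diagrams in a horizontal line *)

Section Flip.
Variables n m : nat.

Definition flip_point (p : point n m) : point m n :=
  match p with inl i => inr i | inr j => inl j end.

Lemma code_flip_point p : code (flip_point p) = (- code p - 1)%R.
Proof. by case: p => i /=; lia. Qed.

End Flip.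

Lemma flip_pointK n m : cancel (@flip_point n m) (@flip_point m n).
Proof. by case. Qed.

Lemma flip_planar n m (x : diagram n m) :
  planar_pairing [ffun p => flip_point (x (flip_point p))].
Proof.
have lt (p q : point m n) : (place (flip_point p) < place (flip_point q)) = (place q < place p).
  have := place_code p; have := place_code q; have := place_code (flip_point p).
  have := place_code (flip_point q); rewrite !code_flip_point.
  have := code_bounds p; have := code_bounds q; do 4! case: ifP; lia.
have lt' (p q : point n m) : (place (flip_point p) < place (flip_point q)) = (place q < place p).
  by rewrite -[p in RHS]flip_pointK -[q in RHS]flip_pointK lt.
apply/and3P; split; apply/forallP => p; rewrite ?ffunE.
- rewrite -(inj_eq (can_inj (@flip_pointK _ _))) flip_pointK; exact: partner_neq.
- by rewrite !flip_pointK partnerK flip_pointK.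
apply/forallP => q; rewrite !ffunE; apply/negP => /and3P[].
rewrite -[place p < place q]lt => H1.
rewrite -{1}(flip_pointK q) !lt' => H2 H3.
(* Reflection reverses the order of the four points, so the crossing is read from its other end. *)
apply: (@partner_nocross _ _ x (x (flip_point q)) (x (flip_point p))) => //;
  by rewrite !partnerK.
Qed.

Definition flip n m (x : diagram n m) : diagram m n := Diagram (flip_planar x).

Lemma flipE n m (x : diagram n m) p : flip x p = flip_point (x (flip_point p)).
Proof. by rewrite ffunE. Qed.

Lemma flipK n m : cancel (@flip n m) (@flip m n).
Proof. by move=> x; apply: diagram_eq => p; rewrite !flipE !flip_pointK. Qed.

Lemma code_flip n m (x : diagram n m) p :
  code (flip x p) = (- code (x (flip_point p)) - 1)%R.
Proof. by rewrite flipE code_flip_point. Qed.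

Section FlipConcat.
Variables (n m l : nat) (x : diagram n m) (y : diagram m l).
Let swap n m l (u : point n m + point m l) : point l m + point m n :=
  match u with inl p => inr (flip_point p) | inr q => inl (flip_point q) end.

(** [swap] is an isomorphism between the two glued graphs and carries outer points to outer
    points. *)
Lemma is_concat_flip z : is_concat x y z -> is_concat (flip y) (flip x) (flip z).
Proof.
have sw n0 m0 l0 (a : diagram n0 m0) (b : diagram m0 l0) u v : glued a b u v ->
    connect (glued (flip b) (flip a)) (swap u) (swap v).
  move=> H; apply: connect1; case: u v H => [[i|i]|[i|i]] [[j|j]|[j|j]] //=;
    by [move/eqP=> H; rewrite flipE /= -H | rewrite eq_sym].
have swK n0 m0 l0 (u : point n0 m0 + point m0 l0) : swap (swap u) = u.
  by case: u => [[?|?]|[?|?]].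
have so n0 m0 l0 (p : point n0 l0) : swap (outer m0 p) = outer m0 (flip_point p).
  by case: p.
have con u v : connect (glued (flip y) (flip x)) u v = connect (glued x y) (swap u) (swap v).
  apply/idP/idP => H.
    by have := connect_img (@sw _ _ _ (flip y) (flip x)) H; rewrite !flipK.
  by have := connect_img (@sw _ _ _ x y) H; rewrite !swK.
move=> /is_concatP[H1 H2]; apply/is_concatP; split=> [p q|u].
  rewrite con !so H1 flipE (inj_eq (can_inj (@flip_pointK _ _))); congr (_ || _).
  by apply/eqP/eqP => [<-|->]; rewrite flip_pointK.
by have [p Hp] := H2 (swap u); exists (flip_point p); rewrite con so flip_pointK.
Qed.

End FlipConcat.

Lemma concat_flip n m l (x : diagram n m) (y : diagram m l) :
  concat (flip y) (flip x) = omap (@flip n l) (concat x y).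
Proof.
case E: (concat x y) => [z|] /=.
  by apply/eqP; rewrite concatE; apply: is_concat_flip; rewrite -concatE E.
case E': (concat _ _) => [z|] //; move/eqP: E'; rewrite concatE => /is_concat_flip.
by rewrite !flipK -concatE E.
Qed.

Ltac ifs := do ?[case: leqP => ? | case: ifP => ?]; lia.

(* [delta i] on codes.  Likewise [ecode i], [uecode i], [gcode i] and [tcode] below
   are [skip i], its left inverse, [gamma i] and [tens] on codes, and [rcode g i] is
   [reroute] for the diagram with code function [g]. *)
Definition dcode (i : nat) (c : int) : int :=
  (if 0 <= c then
     if c < i%:Z then - c - 1 else if c == i%:Z then c + 1
     else if c == i%:Z + 1 then c - 1 else 1 - c
   else if - c - 1 < i%:Z then - c - 1 else 1 - c)%R.

Lemma code_delta l (i : 'I_l.+1) p : code (delta i p) = dcode i (code p).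
Proof.
rewrite ffunE /dcode; case: p => [j|k] /=.
  case: unliftP => [j'|] -> /=; last by rewrite eqxx /= /bump; ifs.
  case: unliftP => [k|] -> /=.
    by rewrite /bump; ifs.
  by rewrite [_ == widen_ord _ _]eq_sym (negPf (neq_lift _ _)) /= /bump leqnn; ifs.
by rewrite /bump; ifs.
Qed.

(** * Concatenation with a single cup *)

Section Gaps.
Variables (l : nat) (i : 'I_l.+1).

Definition left_pt : 'I_l.+2 := widen_ord (leqnSn l.+1) i.
Definition right_pt : 'I_l.+2 := lift ord0 i.

Definition ecode (i : nat) (c : int) : int :=
  (if (0 <= c) || (- c - 1 < i%:Z) then c else c - 2)%R.

Definition skip n (p : point n l) : point n l.+2 :=
  match p with inl a => inl a | inr k => inr (lift left_pt (lift i k)) end.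

Lemma code_skip n (p : point n l) : code (skip p) = ecode i (code p).
Proof.
by rewrite /ecode; case: p => [a|k] /=; rewrite ?/bump; ifs.
Qed.

Lemma code_left n : code (inr left_pt : point n l.+2) = (- i%:Z - 1)%R.
Proof. by []. Qed.

Lemma code_right n : code (inr right_pt : point n l.+2) = (- i%:Z - 2)%R.
Proof. by rewrite /= /bump; lia. Qed.

Lemma skip_cover n (q : point n l.+2) :
  [\/ q = inr left_pt, q = inr right_pt | exists p, q = skip p].
Proof.
have [E|N] := eqVneq (code q) (- i%:Z - 1)%R.
  by apply: Or31; apply: code_inj; rewrite E.
have [E|N'] := eqVneq (code q) (- i%:Z - 2)%R.
  by apply: Or32; apply: code_inj; rewrite E code_right.
apply: Or33; have := code_bounds q; have := ltn_ord i => Hi Hq.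
have [|p Hp] := @code_surj n l (if (code q < - i%:Z - 1)%R then code q + 2 else code q)%R.
  by case: ifP; lia.
by exists p; apply: code_inj; rewrite code_skip; move: Hp; case: ifP => ? ->; rewrite /ecode; ifs.
Qed.

Lemma skip_left n (p : point n l) : skip p != inr left_pt.
Proof.
apply/eqP => /(congr1 (@code _ _)); rewrite code_skip code_left /ecode.
by case: ifP; lia.
Qed.

Lemma skip_right n (p : point n l) : skip p != inr right_pt.
Proof.
apply/eqP => /(congr1 (@code _ _)); rewrite code_skip code_right /ecode.
by case: ifP; lia.
Qed.

Lemma skip_lt n (p q : point n l) :
  (place (skip p) < place (skip q)) = (place p < place q).
Proof.
have := ltn_ord i.
by case: p q => [[a Ha]|[k Hk]] [[a' Ha']|[k' Hk']] /=; rewrite ?/bump; ifs.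
Qed.

Lemma place_right n :
  place (inr left_pt : point n l.+2) = (place (inr right_pt : point n l.+2)).+1.
Proof. by rewrite /= /bump; have := ltn_ord i; lia. Qed.

Lemma delta_left : delta i (inl left_pt) = inl right_pt.
Proof.
apply: code_inj; rewrite code_delta /= /dcode /bump.
by ifs.
Qed.

Lemma delta_right : delta i (inl right_pt) = inl left_pt.
Proof. by rewrite -delta_left partnerK. Qed.

Lemma delta_inr k : delta i (inr k) = inl (lift left_pt (lift i k)).
Proof. by rewrite ffunE. Qed.

Lemma delta_skip k : delta i (inl (lift left_pt (lift i k))) = inr k.
Proof. by rewrite -delta_inr partnerK. Qed.

Section ConcatDelta.
Variables (n : nat) (x : diagram n l.+2).

(** Where a path that has arrived at [q] ends once the cup is attached: at one end of the cup it
    crosses over and leaves along the curve of [x] from the other end. *)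
Definition reroute (q : point n l.+2) : point n l.+2 :=
  if q == inr left_pt then x (inr right_pt)
  else if q == inr right_pt then x (inr left_pt) else q.

(** The four glued copies of the two points form a set closed under [glued] and without outer
    points. *)
Lemma concat_delta_loop : x (inr left_pt) = inr right_pt -> concat x (delta i) = None.
Proof.
move=> xl; case E: concat => [z|] //; move/eqP: E; rewrite concatE => /is_concatP[_].
move/(_ (inl (inr left_pt))) => [p].
have xr : x (inr right_pt) = inr left_pt by rewrite -xl partnerK.
pose S : pred (point n l.+2 + point l.+2 l) := fun u => match u with
  | inl (inr b) | inr (inl b) => (b == left_pt) || (b == right_pt) | _ => false end.
have cl : closed (glued x (delta i)) S.
  apply: intro_closed => [|u v]; first exact: glued_sym.
  case: u v => [[a|b]|[b|a]] [[a'|b']|[b'|a']] //=; rewrite ?unfold_in /=;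
    try by [move=> /eqP->].
  - by move=> /eqP + /orP[] /eqP E; rewrite E ?xl ?xr.
  - by move=> /eqP + /orP[] /eqP E; rewrite E ?xl ?xr => -[->]; rewrite eqxx ?orbT.
  - by move=> /eqP + /orP[] /eqP E; rewrite E ?delta_left ?delta_right => -[->]; rewrite eqxx ?orbT.
  - by move=> /eqP + /orP[] /eqP E; rewrite E ?delta_left ?delta_right.
move/(closed_connect cl); rewrite !unfold_in /= eqxx.
by case: p.
Qed.

Lemma concat_delta : x (inr left_pt) != inr right_pt ->
  exists2 z, concat x (delta i) = Some z &
    forall p, skip (z p) = reroute (x (skip p)).
Proof.
move=> xl; have [z Hz] := joined_exists x (delta i).
have csym := glued_sym x (delta i).
have xe q : connect (glued x (delta i)) (inl q) (inl (x q)).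
  by apply: connect1; rewrite /= eqxx.
have ge b : connect (glued x (delta i)) (inl (inr b)) (inr (inl b)).
  by apply: connect1; rewrite /= eqxx.
have eo p : connect (glued x (delta i)) (inl (skip p)) (outer l.+2 p).
  case: p => [a|k] /=; first exact: connect0.
  apply: connect_trans (ge _) _; apply: connect1 => /=.
  by rewrite delta_skip.
have lr : connect (glued x (delta i)) (inl (inr left_pt)) (inl (inr right_pt)).
  apply: connect_trans (ge _) _; rewrite csym; apply: connect_trans (ge _) _.
  by apply: connect1; rewrite /= delta_right.
have rr q : connect (glued x (delta i)) (inl q) (inl (reroute q)).
  rewrite /reroute; case: eqP => [->|_]; first exact: connect_trans lr (xe _).
  by case: eqP => [->|_] //; rewrite csym in lr; exact: connect_trans lr (xe _).
have xr : x (inr right_pt) != inr left_pt.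
  by apply: contra xl => /eqP <-; rewrite partnerK.
have nlr : inr right_pt != inr left_pt :> point n l.+2.
  by apply/eqP => /(congr1 (@code _ _)); rewrite code_left code_right; lia.
(* Rerouting always escapes from the two joined points, as [x] does not join them to each other.
   Hence every point reaches an outer one and no loop appears. *)
have rsk q : exists p, reroute q = skip p.
  case: (skip_cover (reroute q)) => // E; exfalso; move: E; rewrite /reroute;
    (case: eqP => [_|N]; [|case: eqP => [_|N']]) => E //.
  - by move: xr; rewrite E eqxx.
  - by move: (partner_neq x (inr left_pt)); rewrite E eqxx.
  - by move: (partner_neq x (inr right_pt)); rewrite E eqxx.
  - by move: xl; rewrite E eqxx.
exists z.
  apply/eqP; rewrite concatE; apply/is_concatP; split=> // u.
  have inlc q : exists p, connect (glued x (delta i)) (inl q) (outer l.+2 p).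
    have [p Hp] := rsk q; exists p; apply: connect_trans (rr q) _; rewrite Hp; exact: eo.
  case: u => [//|[b|k]]; last by exists (inr k); apply: connect0.
  have [p Hp] := inlc (inr b); exists p; apply: connect_trans Hp.
  by rewrite csym.
move=> p; have [p' Hp'] := rsk (x (skip p)); rewrite Hp'.
have c : connect (glued x (delta i)) (outer l.+2 p) (outer l.+2 p').
  apply: (@connect_trans _ _ (inl (skip p))); first by rewrite csym.
  apply: connect_trans (xe _) _; apply: connect_trans (rr _) _.
  by rewrite Hp'.
(* [Hz] also allows [p' = p], that is, a rerouted curve returning to its start; this is excluded
   below. *)
rewrite Hz in c; case/orP: c => /eqP E; last by rewrite E.
rewrite {}E in Hp' *.
exfalso; move: Hp'; rewrite /reroute; case: eqP => [E|_].
  by move=> E'; move: nlr; rewrite -E -(partnerK x (inr right_pt)) E' eqxx.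
case: eqP => [E|_] E'; last by have := partner_neq x (skip p); rewrite E' eqxx.
by move: nlr; rewrite -E -(partnerK x (inr left_pt)) E' eqxx.
Qed.

End ConcatDelta.
End Gaps.

(** * Concatenation with a single cap, and factorization through a cap *)

Definition gamma l (i : 'I_l.+1) : diagram l l.+2 := flip (delta i).

Definition gcode (i : nat) (c : int) : int := (- dcode i (- c - 1) - 1)%R.

Lemma code_gamma l (i : 'I_l.+1) p : code (gamma i p) = gcode i (code p).
Proof. by rewrite code_flip code_delta code_flip_point. Qed.

Section ConcatGamma.
Variables (n l : nat) (i : 'I_l.+1).

Lemma gamma_left : gamma i (inr (left_pt i)) = inr (right_pt i).
Proof. by rewrite flipE /= delta_left. Qed.

Lemma gamma_right : gamma i (inr (right_pt i)) = inr (left_pt i).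
Proof. by rewrite -gamma_left partnerK. Qed.

Lemma gamma_inl k : gamma i (inl k) = inr (lift (left_pt i) (lift i k)).
Proof. by rewrite flipE /= delta_inr. Qed.

Lemma concat_gammaE (x : diagram n l) (z : diagram n l.+2) :
  z (inr (left_pt i)) = inr (right_pt i) ->
  (forall p, skip i (x p) = z (skip i p)) -> concat x (gamma i) = Some z.
Proof.
move=> zl zs.
have zr : z (inr (right_pt i)) = inr (left_pt i) by rewrite -zl partnerK.
(* [r] slides each inner point along the vertical strand of [gamma i] to the bottom line. *)
pose r (u : point n l + point l l.+2) : point n l.+2 := match u with
  | inl p => skip i p | inr (inl k) => skip i (inr k) | inr (inr b) => inr b end.
have csym := glued_sym x (gamma i).
have co p : connect (glued x (gamma i)) (inl p) (outer l (skip i p)).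
  case: p => [a|k] /=; first exact: connect0.
  apply: (@connect_trans _ _ (inr (inl k))); apply: connect1; rewrite /= ?eqxx //.
  by rewrite gamma_inl.
apply/eqP; rewrite concatE; apply: (@is_concat_diagram _ _ _ _ _ _ r).
- by case.
- case=> [p|[k|b]] /=; [exact: co | | exact: connect0].
  by apply: connect1; rewrite /= gamma_inl.
- case=> [p|p] [q|q].
  + by move/eqP->; rewrite /= zs eqxx orbT.
  + by case: p q => [a|k] [k'|b] // /eqP ->; rewrite eqxx.
  + by case: p q => [k'|b] [a|k] // /eqP ->; rewrite eqxx.
  move=> E; have {E} : q = gamma i p by apply/eqP.
  case: p => [k|b].
    by rewrite gamma_inl => -> /=; rewrite eqxx.
  case: (skip_cover i (inr b : point n l.+2)) => [[->]|[->]|[p Ep]].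
  + by rewrite gamma_left => ->; rewrite /= zl eqxx orbT.
  + by rewrite gamma_right => ->; rewrite /= zr eqxx orbT.
  case: p Ep => [//|k] [->]; rewrite -{1}gamma_inl partnerK => ->.
  by rewrite /= eqxx.
move=> p; case: (skip_cover i p) => [->|->|[p' ->]].
- by rewrite zl; apply: connect1; rewrite -[glued _ _ _ _]/(_ == _) gamma_left.
- by rewrite zr; apply: connect1; rewrite -[glued _ _ _ _]/(_ == _) gamma_right.
rewrite -zs; apply: connect_trans (co _); rewrite csym; apply: connect_trans (co _).
by apply: connect1; rewrite /= partnerK.
Qed.

Lemma concat_gamma (x : diagram n l) : exists z : diagram n l.+2,
  [/\ concat x (gamma i) = Some z, z (inr (left_pt i)) = inr (right_pt i) &
      forall p, z (skip i p) = skip i (x p)].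
Proof.
have [|||||z zr zs] := @insert_pair _ _ _ _ (@skip _ i n) (inr (right_pt i)) (inr (left_pt i)) _ _ _ _ _ x.
- exact: skip_lt.
- by move=> q; case: (skip_cover i q) => [->|->|?]; [apply: Or32|apply: Or31|apply: Or33].
- by move=> p; apply: skip_right.
- by move=> p; apply: skip_left.
- exact: place_right.
have zl : z (inr (left_pt i)) = inr (right_pt i) by rewrite -zr partnerK.
by exists z; split=> //; apply: concat_gammaE.
Qed.

Lemma capped_concat (z : diagram n l.+2) :
  z (inr (left_pt i)) = inr (right_pt i) ->
  exists x : diagram n l, concat x (gamma i) = Some z.
Proof.
move=> zl.
have [||||x Hx] := @remove_pair _ _ _ _ (@skip _ i n) (inr (left_pt i)) (inr (right_pt i)) _ _ _ _ z zl.
- exact: skip_lt.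
- by move=> q; exact: skip_cover.
- by move=> p; apply: skip_left.
- by move=> p; apply: skip_right.
by exists x; apply: concat_gammaE.
Qed.

Lemma gamma_not_monic : ~~ monic (gamma i).
Proof. by apply/negP => /forallP/(_ (left_pt i)); rewrite gamma_left. Qed.

End ConcatGamma.

(** A cap of least width joins neighbours: the point next to its left end could otherwise only be
    joined across the cap or by a narrower cap beneath it. *)
Lemma not_monic_cap n l (z : diagram n l.+2) : ~~ monic z ->
  exists i : 'I_l.+1, z (inr (left_pt i)) = inr (right_pt i).
Proof.
rewrite negb_forall => /existsP[j0 Hj0].
(* [w] counts the points strictly between the two ends of a cap. *)
pose P w := [exists j : 'I_l.+2, exists k : 'I_l.+2, (z (inr j) == inr k) && (k == j + w.+1 :> nat)].
have exP : exists w, P w.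
  case E: (z (inr j0)) Hj0 => [//|k0] _.
  have nk : j0 != k0 :> nat.
    by apply/eqP => /val_inj E'; move: (partner_neq z (inr j0)); rewrite E E' eqxx.
  have E' : z (inr k0) = inr j0 by rewrite -E partnerK.
  case: (ltngtP j0 k0) => H; last by rewrite H eqxx in nk.
    exists (k0 - j0.+1); apply/existsP; exists j0; apply/existsP; exists k0.
    by rewrite E eqxx /=; lia.
  exists (j0 - k0.+1); apply/existsP; exists k0; apply/existsP; exists j0.
  by rewrite E' eqxx /=; lia.
case: (ex_minnP exP) => w /existsP[j /existsP[k /andP[/eqP E /eqP kE]]] wmin.
have E' : z (inr k) = inr j by rewrite -E partnerK.
have jl : j < l.+1 by have := ltn_ord k; lia.
have [w0|w0] := posnP w.
  exists (Ordinal jl).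
  have -> : left_pt (Ordinal jl) = j by apply: val_inj.
  by rewrite E; congr inr; apply: val_inj; rewrite /= /bump; lia.
have j1l : j.+1 < l.+2 by lia.
pose b := Ordinal j1l.
have pl p q := @partner_nocross _ _ z p q.
have cpt (q : point n l.+2) := place_code q.
case Eb: (z (inr b)) => [a|c].
  have := pl (inl a) (inr k); have Ea : z (inl a) = inr b by rewrite -Eb partnerK.
  rewrite Ea E' /=; have := ltn_ord a; have := ltn_ord k; lia.
have cj : c != j :> nat.
  by apply/eqP => /val_inj Ec; move: (partnerK z (inr b)); rewrite Eb Ec E => -[] /(congr1 val) /=; lia.
have cb : c != b :> nat.
  by apply/eqP => /val_inj Ec; move: (partner_neq z (inr b)); rewrite Eb Ec eqxx.
have Ec : z (inr c) = inr b by rewrite -Eb partnerK.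
have ck : c != k :> nat.
  by apply/eqP => /val_inj Eck; move: E'; rewrite -Eck Ec => -[] /(congr1 val) /=; lia.
have [ltc|gec] := ltnP c j.
  have := pl (inr k) (inr b); rewrite E' Eb /=.
  by have := ltn_ord k; move: cj; rewrite /b /=; lia.
have [ltk|gek] := ltnP k c.
  have := pl (inr c) (inr k); rewrite Ec E' /=.
  by have := ltn_ord c; rewrite /b /=; lia.
have /wmin : P (c - j.+2).
  apply/existsP; exists b; apply/existsP; exists c; rewrite Eb eqxx /=.
  by move: cb; rewrite /b /=; lia.
lia.
Qed.

Lemma not_monic_concat n l (z : diagram n l.+2) : ~~ monic z ->
  exists (i : 'I_l.+1) (x : diagram n l), concat x (gamma i) = Some z.
Proof. by move=> /not_monic_cap[i /capped_concat[x Hx]]; exists i, x. Qed.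

(** * Concatenation as linear arithmetic on codes *)

Lemma dcodeP (i : nat) (c v : int) : v = dcode i c ->
  ((0 <= c < i%:Z /\ v = - c - 1) \/ (c = i%:Z /\ v = c + 1) \/
   (c = i%:Z + 1 /\ v = c - 1) \/ (i%:Z + 1 < c /\ v = 1 - c) \/
   (c < 0 /\ - c - 1 < i%:Z /\ v = - c - 1) \/
   (c < 0 /\ i%:Z <= - c - 1 /\ v = 1 - c))%R.
Proof. by move=> ->; rewrite /dcode; ifs. Qed.

Lemma gcodeP (i : nat) (c v : int) : v = gcode i c ->
  ((0 <= - c - 1 < i%:Z /\ v = - c - 1) \/ (- c - 1 = i%:Z /\ v = c - 1) \/
   (- c - 1 = i%:Z + 1 /\ v = c + 1) \/ (i%:Z + 1 < - c - 1 /\ v = - c - 3%:Z) \/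
   (0 <= c /\ c < i%:Z /\ v = - c - 1) \/
   (0 <= c /\ i%:Z <= c /\ v = - c - 3%:Z))%R.
Proof. by move=> ->; have := dcodeP (erefl (dcode i (- c - 1)%R)); rewrite /gcode; lia. Qed.

Lemma ecodeP (i : nat) (c v : int) : v = ecode i c ->
  ((0 <= c /\ v = c) \/ (c < 0 /\ - c - 1 < i%:Z /\ v = c) \/
   (c < 0 /\ i%:Z <= - c - 1 /\ v = c - 2))%R.
Proof. by move=> ->; rewrite /ecode; ifs. Qed.

Definition uecode (i : nat) (c : int) : int :=
  (if (0 <= c) || (- c - 1 < i%:Z) then c else c + 2)%R.

Lemma uecodeP (i : nat) (c v : int) : v = uecode i c ->
  ((0 <= c /\ v = c) \/ (c < 0 /\ - c - 1 < i%:Z /\ v = c) \/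
   (c < 0 /\ i%:Z <= - c - 1 /\ v = c + 2))%R.
Proof. by move=> ->; rewrite /uecode; ifs. Qed.

Lemma ecodeK i : cancel (ecode i) (uecode i).
Proof. by move=> c; have := ecodeP (erefl (ecode i c)); have := uecodeP (erefl (uecode i (ecode i c))); lia. Qed.

(* The index is a natural number, so that delta and gamma on different numbers of
   strands can be compared. *)
Definition dl l (i : nat) : diagram l.+2 l := delta (inord i).
Definition gm l (i : nat) : diagram l l.+2 := gamma (inord i).

Lemma flip_gm l i : flip (gm l i) = dl l i. Proof. exact: flipK. Qed.

Lemma code_dl l i p : i <= l -> code (dl l i p) = dcode i (code p).
Proof. by move=> il; rewrite code_delta inordK. Qed.

Lemma code_gm l i p : i <= l -> code (gm l i p) = gcode i (code p).
Proof. by move=> il; rewrite code_gamma inordK. Qed.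

Definition rcode (g : int -> int) (i : nat) (c : int) : int :=
  (if c == - i%:Z - 1 then g (- i%:Z - 2) else if c == - i%:Z - 2 then g (- i%:Z - 1)
   else c)%R.

Lemma rcodeP g i (c v : int) : v = rcode g i c ->
  ((c = - i%:Z - 1 /\ v = g (- i%:Z - 2)) \/ (c = - i%:Z - 2 /\ v = g (- i%:Z - 1)) \/
   (c != - i%:Z - 1 /\ c != - i%:Z - 2 /\ v = c))%R.
Proof.
move=> ->; rewrite /rcode; case: eqP => [->|/eqP ?]; first by left.
by right; case: eqP => [->|/eqP ?]; [left|right].
Qed.

(** [code_split] replaces an innermost code function, one whose argument contains no other, by its
    linear cases; [code_arith] iterates this, discards contradictory branches and leaves the rest to
    [lia]. *)
Ltac code_free c := lazymatch c with
  | context [dcode] => fail | context [gcode] => fail | context [ecode] => fail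
  | context [rcode] => fail | context [uecode] => fail | _ => idtac end.

Ltac code_split := match goal with
  | |- context [ecode ?i ?c] => code_free c;
    move: (ecode i c) (ecodeP (erefl (ecode i c))) => ? [[? ->]|[[? [? ->]]|[? [? ->]]]]
  | |- context [uecode ?i ?c] => code_free c;
    move: (uecode i c) (uecodeP (erefl (uecode i c))) => ? [[? ->]|[[? [? ->]]|[? [? ->]]]]
  | |- context [dcode ?i ?c] => code_free c;
    move: (dcode i c) (dcodeP (erefl (dcode i c))) =>
      ? [[? ->]|[[? ->]|[[? ->]|[[? ->]|[[? [? ->]]|[? [? ->]]]]]]]
  | |- context [gcode ?i ?c] => code_free c;
    move: (gcode i c) (gcodeP (erefl (gcode i c))) =>
      ? [[? ->]|[[? ->]|[[? ->]|[[? ->]|[[? [? ->]]|[? [? ->]]]]]]]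
  | |- context [rcode ?g ?i ?c] => code_free c;
    move: (rcode g i c) (rcodeP (erefl (rcode g i c))) =>
      ? [[? ->]|[[? ->]|[? [? ->]]]]
  end.

Ltac code_arith := cbv beta; first [code_split; first [by exfalso; lia | code_arith] | lia].

(** The function [g] need only agree with [x] on codes of points, so it may be a closed formula such
    as [dcode i] or [gcode i], and the product is again given by a formula. *)
Lemma concat_dl n l (x : diagram n l.+2) i (g : int -> int) : i <= l ->
  (forall p, code (x p) = g (code p)) -> (g (- i%:Z - 1) != - i%:Z - 2)%R ->
  exists2 z, concat x (dl l i) = Some z &
    forall p, code (z p) = uecode i (rcode g i (g (ecode i (code p)))).
Proof.
move=> il xg H; have [|z Hz zE] := @concat_delta l (inord i) n x.
  by rewrite -(inj_eq (@code_inj _ _)) xg code_right code_left inordK.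
exists z => // p; have := congr1 (@code _ _) (zE p).
rewrite -[code (z p)](ecodeK i).
have -> : ecode i (code p) = code (skip (inord i : 'I_l.+1) p) by rewrite code_skip inordK.
rewrite code_skip inordK // => ->; congr uecode; rewrite /rcode -xg.
rewrite /reroute -!(inj_eq (@code_inj _ _)) code_right code_left inordK //.
case: eqP => _; first by rewrite xg code_right inordK.
by case: eqP => _; first by rewrite xg code_left inordK.
Qed.

Lemma concat_dl_None n l (x : diagram n l.+2) i : i <= l ->
  (forall p, code p = - i%:Z - 1 -> code (x p) = - i%:Z - 2)%R ->
  concat x (dl l i) = None.
Proof.
move=> il H; apply: concat_delta_loop; apply: code_inj.
rewrite code_right inordK //; apply: H; by rewrite code_left inordK.
Qed.

Lemma concat_gm n l (x : diagram n l) i (z : diagram n l.+2) (g h : int -> int) : i <= l ->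
  (forall p, code (x p) = g (code p)) -> (forall p, code (z p) = h (code p)) ->
  (h (- i%:Z - 1) = - i%:Z - 2)%R ->
  (forall c : int, (- l%:Z <= c < n%:Z)%R -> h (ecode i c) = ecode i (g c)) ->
  concat x (gm l i) = Some z.
Proof.
move=> il xg zh hl hs; apply: concat_gammaE => [|p]; apply: code_inj.
  by rewrite zh code_left code_right inordK.
by rewrite zh !code_skip inordK // xg hs // code_bounds.
Qed.

(** * The category of diagrams *)

(** With [None] as a zero morphism, composition is total and associative. *)
Definition comp n m l (a : option (diagram n m)) (b : option (diagram m l)) :
  option (diagram n l) := obind (fun x => obind (fun y => concat x y) b) a.
Arguments comp : simpl never.

Notation "a ** b" := (comp a b) (at level 40, left associativity).
Notation Id n := (Some (id_diagram n)).
Notation Dl l i := (Some (dl l i)).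
Notation Gm l i := (Some (gm l i)).

Lemma compA n m l k (a : option (diagram n m)) (b : option (diagram m l))
  (c : option (diagram l k)) : a ** b ** c = a ** (b ** c).
Proof.
rewrite /comp; case: a => [x|] //=; case: b => [y|] //=; case: c => [w|] /=.
  by rewrite -concatA; case: (concat x y).
by case: (concat x y).
Qed.

Lemma comp1l n m (a : option (diagram n m)) : Id n ** a = a.
Proof. by rewrite /comp; case: a => [x|] //=; rewrite concat_id_left. Qed.

Lemma compl1 n m (a : option (diagram n m)) : a ** Id m = a.
Proof. by rewrite /comp; case: a => [x|] //=; rewrite concat_id_right. Qed.

Lemma comp_None n m l (a : option (diagram n m)) : a ** (None : option (diagram m l)) = None.
Proof. by case: a. Qed.

Lemma None_comp n m l (b : option (diagram m l)) : (None : option (diagram n m)) ** b = None.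
Proof. by []. Qed.

Lemma flip_comp n m l (a : option (diagram n m)) (b : option (diagram m l)) :
  omap (@flip n l) (a ** b) = omap (@flip m l) b ** omap (@flip n m) a.
Proof. by rewrite /comp; case: a b => [x|] [y|] //=; rewrite concat_flip. Qed.

Lemma omap_flipK n m : cancel (omap (@flip n m)) (omap (@flip m n)).
Proof. by case=> [x|] //=; rewrite flipK. Qed.

(** * Relations between cups and caps *)

Lemma dl_dl l i j : i <= j -> j <= l ->
  Dl l.+2 i ** Dl l j = Dl l.+2 j.+2 ** Dl l i.
Proof.
move=> ij jl; rewrite /comp /=.
have [||z -> Hz] := @concat_dl _ _ (dl l.+2 i) j (dcode i) jl.
- by move=> p; rewrite code_dl //; lia.
- by have := dcodeP (erefl (dcode i (- j%:Z - 1)%R)); lia.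
have [|||w -> Hw] := @concat_dl _ _ (dl l.+2 j.+2) i (dcode j.+2).
- lia.
- by move=> p; rewrite code_dl //; lia.
- by have := dcodeP (erefl (dcode j.+2 (- i%:Z - 1)%R)); lia.
congr Some; apply: diagram_eq_code => p.
rewrite {}Hz {}Hw; move: (code p) (code_bounds p) => c {z w p} ?.
code_arith.
Qed.

Lemma gm_dl_same l i : i <= l -> Gm l i ** Dl l i = None.
Proof.
move=> il; rewrite /comp /=; apply: concat_dl_None => // p; rewrite code_gm // => ->.
by code_arith.
Qed.

(** The cap and the cup share one point and form a zigzag, which straightens to a strand. *)
Lemma gm_dl_succ l i : i < l -> Gm l i ** Dl l i.+1 = Id l.
Proof.
move=> il; rewrite /comp /=; have [||z -> Hz] := @concat_dl _ _ (gm l i) i.+1 (gcode i) il.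
- by move=> p; rewrite code_gm //; lia.
- by code_arith.
congr Some; apply: diagram_eq_code => p; rewrite {}Hz.
have -> : code (id_diagram l p) = (- code p - 1)%R by rewrite ffunE; case: p => p /=; lia.
move: (code p) (code_bounds p) => c {z p} ?.
code_arith.
Qed.

Lemma flip_id n : flip (id_diagram n) = id_diagram n.
Proof. by apply: diagram_eq => p; rewrite flipE !ffunE; case: p. Qed.

Lemma gm_dl_pred l i : i < l -> Gm l i.+1 ** Dl l i = Id l.
Proof.
by move=> /gm_dl_succ/(congr1 (omap (@flip _ _))); rewrite flip_comp /= flip_id flip_gm.
Qed.

(** The cap and the cup share no point and slide past each other; the cup then loses the two
    positions of the cap on its left. *)
Lemma gm_dl_far l i j : i <= j -> j <= l ->
  Gm l.+2 i ** Dl l.+2 j.+2 = Dl l j ** Gm l i.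
Proof.
move=> ij jl; rewrite /comp /=.
have [|||z -> Hz] := @concat_dl _ _ (gm l.+2 i) j.+2 (gcode i).
- lia.
- by move=> p; rewrite code_gm //; lia.
- by code_arith.
pose h c := uecode j.+2 (rcode (gcode i) j.+2 (gcode i (ecode j.+2 c))).
symmetry; apply: (@concat_gm _ _ (dl l j) i z (dcode j) h) => [|p|//||c ?]; rewrite ?/h.
- lia.
- by exact: code_dl.
- by code_arith.
- by code_arith.
Qed.

Lemma gm_dl_far' l i j : i <= j -> j <= l ->
  Gm l.+2 j.+2 ** Dl l.+2 i = Dl l i ** Gm l j.
Proof.

move=> ij jl; have := congr1 (omap (@flip _ _)) (gm_dl_far ij jl).
by rewrite !flip_comp /= !flip_gm.
Qed.

(** * Adding a strand, and bending the last one *)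

Section CodeFun.
Variables (n m : nat) (x : diagram n m).

(** This gives a code function for an arbitrary diagram, so that [concat_dl] applies to it. *)
Definition cfun (c : int) : int :=
  if [pick p | code p == c] is Some p then code (x p) else c.

Lemma cfunE p : code (x p) = cfun (code p).
Proof.
rewrite /cfun; case: pickP => [q /eqP/code_inj->//|/(_ p)].
by rewrite eqxx.
Qed.

Lemma cfun_bounds c : (- m%:Z <= c < n%:Z)%R -> (- m%:Z <= cfun c < n%:Z)%R.
Proof. by move=> /code_surj[p <-]; rewrite -cfunE code_bounds. Qed.

Lemma cfun_neq c : (- m%:Z <= c < n%:Z)%R -> cfun c <> c.
Proof. by move=> /code_surj[p <-]; rewrite -cfunE => /code_inj/eqP; rewrite (negPf (partner_neq x p)). Qed.

End CodeFun.

Section Strand.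
Variables n m : nat.

Definition widen_pt (p : point n m) : point n.+1 m.+1 :=
  match p with inl i => inl (widen_ord (leqnSn n) i) | inr j => inr (widen_ord (leqnSn m) j) end.

Lemma code_widen p : code (widen_pt p) = code p.
Proof. by case: p. Qed.

Lemma widen_lt p q : (place (widen_pt p) < place (widen_pt q)) = (place p < place q).
Proof. by case: p q => [[a Ha]|[k Hk]] [[a' Ha']|[k' Hk']] /=; lia. Qed.

Lemma widen_cover q : [\/ q = inl ord_max, q = inr ord_max | exists p, q = widen_pt p].
Proof.
have [E|N] := eqVneq (code q) (n%:Z)%R; first by apply: Or31; apply: code_inj; rewrite E.
have [E|N'] := eqVneq (code q) (- m%:Z - 1)%R; first by apply: Or32; apply: code_inj; rewrite E.
have := code_bounds q => Hq; have [|p Hp] := @code_surj n m (code q); first lia.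
by apply: Or33; exists p; apply: code_inj; rewrite code_widen.
Qed.

Lemma widen_top p : widen_pt p != inl ord_max.
Proof.
by apply/eqP => /(congr1 (@code _ _)); rewrite code_widen /=; have := code_bounds p; lia.
Qed.

Lemma widen_bot p : widen_pt p != inr ord_max.
Proof.
by apply/eqP => /(congr1 (@code _ _)); rewrite code_widen /=; have := code_bounds p; lia.
Qed.

Lemma place_strand :
  place (inr ord_max : point n.+1 m.+1) = (place (inl ord_max : point n.+1 m.+1)).+1.
Proof. by rewrite /=; lia. Qed.

(* [x] with a vertical strand added on its right. *)
Definition tens (x : diagram n m) : diagram n.+1 m.+1 :=
  s2val (insert_pair widen_lt widen_cover widen_top widen_bot place_strand x).

Lemma tens_top x : tens x (inl ord_max) = inr ord_max.
Proof. by rewrite /tens; case: insert_pair. Qed.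

Lemma tens_bot x : tens x (inr ord_max) = inl ord_max.
Proof. by rewrite -(tens_top x) partnerK. Qed.

Lemma tens_widen x p : tens x (widen_pt p) = widen_pt (x p).
Proof. by rewrite /tens; case: insert_pair. Qed.

Lemma tens_inj : injective tens.
Proof.
move=> x y E; apply: diagram_eq_code => p.
by rewrite -code_widen -tens_widen E tens_widen code_widen.
Qed.

Lemma tensP (z : diagram n.+1 m.+1) : z (inl ord_max) = inr ord_max -> exists x, z = tens x.
Proof.
move=> E; have [x Hx] := remove_pair widen_lt widen_cover widen_top widen_bot E.
exists x; apply: diagram_eq => q; case: (widen_cover q) => [->|->|[p ->]].
- by rewrite tens_top.
- by rewrite -E partnerK E tens_bot.
- by rewrite -Hx tens_widen.
Qed.

Lemma tens_monic x : monic (tens x) = monic x.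
Proof.
apply/forallP/forallP => H j.
  have := H (widen_ord (leqnSn m) j).
  by rewrite -[inr _]/(widen_pt (inr j)) tens_widen; case: (x _).
case: (widen_cover (inr j)) => [//|[->]|[[//|k] [->]]]; first by rewrite tens_bot.
by rewrite -[inr _]/(widen_pt (inr k)) tens_widen; have := H k; case: (x _).
Qed.

Definition tcode (g : int -> int) (c : int) : int :=
  (if c == n%:Z then - m%:Z - 1 else if c == - m%:Z - 1 then n%:Z else g c)%R.

Lemma code_tens (x : diagram n m) g p : (forall p, code (x p) = g (code p)) -> code (tens x p) = tcode g (code p).
Proof.
move=> xg; rewrite /tcode; case: (widen_cover p) => [->|->|[q ->]].
- by rewrite tens_top eqxx.
- by rewrite tens_bot; case: eqP => /=; [lia|rewrite eqxx].
- rewrite tens_widen !code_widen -xg; have := code_bounds q.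
  by case: eqP; first lia; case: eqP => //; lia.
Qed.

Lemma tcode_in g (c : int) : (- m%:Z <= c < n%:Z)%R -> tcode g c = g c.
Proof. by move=> ?; rewrite /tcode; case: eqP; first lia; case: eqP => //; lia. Qed.

End Strand.

Lemma tens_id n : tens (id_diagram n) = id_diagram n.+1.
Proof.
apply: diagram_eq => p; rewrite ffunE; case: (widen_cover p) => [->|->|[q ->]].
- exact: tens_top.
- exact: tens_bot.
- by rewrite tens_widen ffunE; case: q.
Qed.

Lemma flip_tens n m (x : diagram n m) : flip (tens x) = tens (flip x).
Proof.
apply: diagram_eq => p; rewrite flipE; case: (widen_cover p) => [->|->|[q ->]].
- by rewrite /= tens_bot tens_top.
- by rewrite /= tens_bot tens_top.
- have -> : flip_point (widen_pt q) = widen_pt (flip_point q) by case: q.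
  by rewrite !tens_widen flipE; case: (x _).
Qed.

Lemma tens_dl1 n l (x : diagram n l.+2) i : i <= l ->
  Some (tens x) ** Dl l.+1 i = omap (@tens n l) (Some x ** Dl l i).
Proof.
move=> il; rewrite /comp /=; have gx := cfunE x; have gb := @cfun_bounds _ _ x.
have tx p := @code_tens _ _ x _ p gx.
have b1 : (- l.+2%:Z <= - i%:Z - 1 < n%:Z)%R by lia.
have b2 : (- l.+2%:Z <= - i%:Z - 2 < n%:Z)%R by lia.
have [E|N] := eqVneq (cfun x (- i%:Z - 1)%R) (- i%:Z - 2)%R.
  rewrite (concat_dl_None il) => [|p Hp]; last by rewrite gx Hp.
  rewrite concat_dl_None => [//||p Hp]; first exact: leqW il.
  by rewrite tx Hp tcode_in.
have [z -> Hz] := concat_dl il gx N.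
have [||z' -> Hz'] := @concat_dl _ _ (tens x) i _ _ tx.
- exact: leqW il.
- by rewrite tcode_in.
pose h c := uecode i (rcode (cfun x) i (cfun x (ecode i c))).
congr Some; apply: diagram_eq_code => p; rewrite {}Hz' (@code_tens _ _ z h p Hz).
move: (code_bounds p); move: (code p) => c Hc.
(* The two ends of the added strand are treated first; at all other points [tcode] is the code
   function of [x]. *)
have [{Hc}->|cn] := eqVneq c (n%:Z)%R.
  have -> : ecode i n = n by have := ecodeP (erefl (ecode i n)); lia.
  have T k g : tcode n k g n = (- k%:Z - 1)%R by rewrite /tcode eqxx.
  rewrite !T.
  by have := rcodeP (erefl (rcode (tcode n l.+2 (cfun x)) i (- l.+2%:Z - 1)%R));
    move: (rcode _ _ _) => v; have := uecodeP (erefl (uecode i v)); lia.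
have [{Hc}->|cm] := eqVneq c (- l%:Z - 1)%R.
  have -> : ecode i (- l%:Z - 1)%R = (- l.+2%:Z - 1)%R.
    by have := ecodeP (erefl (ecode i (- l%:Z - 1)%R)); lia.
  have T k : tcode n k (cfun x) (- k%:Z - 1)%R = n.
    by rewrite /tcode; case: eqP; [lia|rewrite eqxx].
  rewrite T; have -> : tcode n l h (- l%:Z - 1)%R = n.
    by rewrite /tcode; case: eqP; [lia|rewrite eqxx].
  by have := rcodeP (erefl (rcode (tcode n l.+2 (cfun x)) i n));
    move: (rcode _ _ _) => v; have := uecodeP (erefl (uecode i v)); lia.
have Hc' : (- l%:Z <= c < n%:Z)%R by lia.
have He : (- l.+2%:Z <= ecode i c < n%:Z)%R by have := ecodeP (erefl (ecode i c)); lia.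
rewrite [RHS]tcode_in // [tcode _ _ _ (ecode i c)]tcode_in //.
congr uecode; rewrite /rcode; case: eqP => _; first by rewrite tcode_in.
by case: eqP => _; first by rewrite tcode_in.
Qed.

Lemma tens_dl n l (a : option (diagram n l.+2)) i : i <= l ->
  omap (@tens _ _) (a ** Dl l i) = omap (@tens _ _) a ** Dl l.+1 i.
Proof. by case: a => [x|] // il; rewrite -tens_dl1. Qed.

Lemma omap_flip_tens n m (a : option (diagram n m)) :
  omap (@flip _ _) (omap (@tens _ _) a) = omap (@tens _ _) (omap (@flip _ _) a).
Proof. by case: a => //= x; rewrite flip_tens. Qed.

Lemma tens_gm n l (a : option (diagram n.+2 l)) i : i <= n ->
  omap (@tens _ _) (Gm n i ** a) = Gm n.+1 i ** omap (@tens _ _) a.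
Proof.
move=> il; apply: (can_inj (@omap_flipK _ _)).
by rewrite omap_flip_tens !flip_comp omap_flip_tens /= !flip_gm -tens_dl.
Qed.

Section Close.
Variables n l : nat.

Definition bend (p : point n l.+1) : point n.+1 l := match p with
  | inl a => inl (widen_ord (leqnSn n) a)
  | inr b => if unlift ord_max b is Some b' then inr b' else inl ord_max end.

Definition unbend (p : point n.+1 l) : point n l.+1 := match p with
  | inl a => if unlift ord_max a is Some a' then inl a' else inr ord_max
  | inr b => inr (widen_ord (leqnSn l) b) end.

Lemma code_bend p : code (bend p) = (if code p == - l%:Z - 1 then n%:Z else code p)%R.
Proof.
case: p => [[a Ha]|b] /=; first by case: eqP => //; lia.
case: unliftP => [b'|] -> /=; last by rewrite eqxx.
have := ltn_ord b' => Hb.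
have -> : bump l b' = b' by rewrite /bump; lia.
by case: eqP => //; lia.
Qed.

Lemma code_unbend p : code (unbend p) = (if code p == n%:Z then - l%:Z - 1 else code p)%R.
Proof.
case: p => [a|[b Hb]] /=; last by case: eqP => //; lia.
case: unliftP => [a'|] -> /=; last by rewrite eqxx.
have := ltn_ord a' => Ha.
have -> : bump n a' = a' by rewrite /bump; lia.
by case: eqP => //; lia.
Qed.

Lemma bendK : cancel bend unbend.
Proof.
move=> p; apply: code_inj; rewrite code_unbend code_bend; have := code_bounds p.
by case: (code p =P _) => [->|?]; [rewrite eqxx|case: eqP => // ->; lia].
Qed.

Lemma unbendK : cancel unbend bend.
Proof.
move=> p; apply: code_inj; rewrite code_bend code_unbend; have := code_bounds p.
by case: (code p =P _) => [->|?]; [rewrite eqxx|case: eqP => // ->; lia].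
Qed.

(** Clockwise, the last bottom point comes directly after the top line, so bending it up moves no
    point round the boundary and planarity is kept. *)
Lemma place_bend p : place (bend p) = place p.
Proof.
case: p => [//|b] /=; case: unliftP => [b'|] -> /=; last by lia.
have := ltn_ord b' => Hb.
have -> : bump l b' = b' by rewrite /bump; lia.
by move: Hb; rewrite /=; lia.
Qed.

Lemma place_unbend p : place (unbend p) = place p.
Proof. by rewrite -{2}(unbendK p) place_bend. Qed.

Lemma close_planar (y : diagram n l.+1) : planar_pairing [ffun p => bend (y (unbend p))].
Proof.
apply/and3P; split; apply/forallP => p; rewrite ?ffunE.
- by rewrite -(inj_eq (can_inj unbendK)) bendK partner_neq.
- by rewrite bendK partnerK unbendK.
apply/forallP => q; rewrite !ffunE !place_bend -[place p]place_unbend -[place q]place_unbend.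
by apply/negP => /and3P[]; apply: partner_nocross.
Qed.

(* The last bottom point of [y] is bent up, to become the last top point. *)
Definition close (y : diagram n l.+1) : diagram n.+1 l := Diagram (close_planar y).

Lemma closeE y p : close y p = bend (y (unbend p)).
Proof. by rewrite ffunE. Qed.

Lemma close_inj : injective close.
Proof.
move=> y y' E; apply: diagram_eq => p.
by apply: (can_inj bendK); rewrite -{1 2}(bendK p) -!closeE E.
Qed.

Lemma closeP (z : diagram n.+1 l) : exists y, z = close y.
Proof.
have pl : planar_pairing [ffun p => unbend (z (bend p))].
  apply/and3P; split; apply/forallP => p; rewrite ?ffunE.
  - by rewrite -(inj_eq (can_inj bendK)) unbendK partner_neq.
  - by rewrite unbendK partnerK bendK.
  apply/forallP => q; rewrite !ffunE !place_unbend -[place p]place_bend -[place q]place_bend.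
  by apply/negP => /and3P[]; apply: partner_nocross.
exists (Diagram pl); apply: diagram_eq => p.
by rewrite closeE ffunE !unbendK.
Qed.

Lemma close_monic (y : diagram n l.+1) : monic y -> monic (close y).
Proof.
move=> /forallP H; apply/forallP => j; rewrite closeE /=.
by have := H (widen_ord (leqnSn l) j); case: (y _).
Qed.

Lemma close_last (y : diagram n l.+1) : monic y -> exists a, close y (inl ord_max) = inl a.
Proof.
move=> /forallP/(_ ord_max); rewrite closeE /= unlift_none.
by case: (y _) => // a _; exists (widen_ord (leqnSn n) a).
Qed.

(** A cup between the last bottom point of [y] and an added strand is the bent curve. This makes
    [close] a composition, so that [gm_close] follows from [tens_gm]. *)
Lemma tens_dl_last (y : diagram n l.+1) : Some (tens y) ** Dl l l = Some (close y).
Proof.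
have gy := cfunE y; have gb := @cfun_bounds _ _ y; have gn := @cfun_neq _ _ y.
have ty p := @code_tens _ _ y _ p gy.
have b1 : (- l.+1%:Z <= - l%:Z - 1 < n%:Z)%R by lia.
have := gb _ b1; have := gn _ b1; move=> N B; rewrite /comp /=.
have [|z -> Hz] := concat_dl (leqnn l) ty.
  by rewrite tcode_in //; lia.
congr Some; apply: diagram_eq_code => p; rewrite {}Hz closeE code_bend gy code_unbend.
move: (code_bounds p); move: (code p) => c Hc.
have -> : ecode l c = c by have := ecodeP (erefl (ecode l c)); lia.
have [{Hc}->|cn] := eqVneq c (n%:Z)%R.
  rewrite [tcode _ _ _ n%:Z]/tcode !eqxx.
  have -> : rcode (tcode n l.+1 (cfun y)) l (- l.+1%:Z - 1)%R = cfun y (- l%:Z - 1)%R.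
    by rewrite -[RHS](@tcode_in n l.+1) // /rcode; case: eqP; [lia|case: eqP => //; lia].
  case: eqP => // _.
  by have := uecodeP (erefl (uecode l (cfun y (- l%:Z - 1)%R))); lia.
have Hc' : (- l.+1%:Z <= c < n%:Z)%R by lia.
rewrite [tcode _ _ _ c]tcode_in //; have := gb _ Hc'; move: (cfun y c) => v Hv.
case: eqP => [->|Nv].
  have -> : rcode (tcode n l.+1 (cfun y)) l (- l%:Z - 1)%R = n.
    rewrite /rcode eqxx /tcode; case: eqP; first lia; case: eqP => //; lia.
  by have := uecodeP (erefl (uecode l n)); lia.
have -> : rcode (tcode n l.+1 (cfun y)) l v = v.
  by have := rcodeP (erefl (rcode (tcode n l.+1 (cfun y)) l v)); lia.
by have := uecodeP (erefl (uecode l v)); lia.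
Qed.

End Close.

Lemma omap_close n l (a : option (diagram n l.+1)) :
  omap (@close n l) a = omap (@tens _ _) a ** Dl l l.
Proof. by case: a => // y; rewrite tens_dl_last. Qed.

Lemma gm_close n l (a : option (diagram n.+2 l.+1)) i : i <= n ->
  Gm n.+1 i ** omap (@close _ _) a = omap (@close _ _) (Gm n i ** a).
Proof. by move=> il; rewrite !omap_close -compA tens_gm. Qed.

(** * Structure of monic diagrams, by their last top point and by their cups *)

Lemma monic_last_inl n l (x : diagram n.+1 l) a : monic x ->
  x (inl ord_max) = inl a -> exists2 y, monic y & x = close y.
Proof.
have [y ->] := closeP x; move=> /forallP xm xa; exists y => //.
(* The end bent up is joined to a top point of [x], so the last bottom point of [y] is on no cap;
   any other cap of [y] would be a cap of [x]. *)
have ymax b : y (inr ord_max) <> inr b.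
  move=> E; move: xa; rewrite closeE /= unlift_none E /=.
  case: unliftP => // bm; move: (partner_neq y (inr ord_max)).
  by rewrite E bm eqxx.
apply/forallP => j; case: (unliftP ord_max j) => [j'|] ->; last first.
  by case E: (y _) => [//|b]; case: (ymax b).
case E: (y _) => [//|b]; have := xm j'; rewrite closeE /=.
have -> : widen_ord (leqnSn l) j' = lift ord_max j'.
  by apply: val_inj; have := ltn_ord j' => H; rewrite /= /bump leqNgt H.
rewrite E /=; case: unliftP => // bm.
by rewrite bm in E; case: (ymax (lift ord_max j')); rewrite -E partnerK.
Qed.

(** Otherwise the throughline at the last bottom point would cross the one at the last top point. *)
Lemma monic_last_inr n l (x : diagram n.+1 l) b : monic x ->
  x (inl ord_max) = inr b -> b.+1 = l.
Proof.
move=> /forallP xm xb; case: l x b xm xb => [|l] x b xm xb; first by case: b xb.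
have := xm ord_max; case E: (x _) => [a|//] _.
have Ea : x (inl a) = inr ord_max by rewrite -E partnerK.
have [ba|nb] := eqVneq b ord_max; first by rewrite ba.
have na : a != ord_max by apply: contra nb => /eqP am; move: Ea; rewrite am xb => -[->].
have := @partner_nocross _ _ x (inl a) (inl ord_max); rewrite Ea xb /=.
have := ltn_ord a; have := ltn_ord b; move: na nb; rewrite -!(inj_eq val_inj) /=; lia.
Qed.

Lemma monic_tens_or_close n l (x : diagram n.+1 l.+1) : monic x ->
  (exists2 y, monic y & x = tens y) \/ (exists2 y, monic y & x = close y).
Proof.
move=> xm; case E: (x (inl ord_max)) => [a|b]; first by right; apply: monic_last_inl E.
left; have bm : b = ord_max by apply: val_inj; have := monic_last_inr xm E => -[].
have [|y xy] := @tensP _ _ x; first by rewrite E bm.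
by exists y => //; rewrite -tens_monic -xy.
Qed.

Lemma monic_close0 n (x : diagram n.+1 0) : monic x ->
  exists2 y, monic y & x = close y.
Proof.
move=> xm; case E: (x (inl ord_max)) => [a|[]//]; exact: monic_last_inl E.
Qed.

Lemma tens_close n l (y : diagram n l) (y' : diagram n l.+2) : monic y' ->
  tens y <> close y'.
Proof. by move=> /close_last[a] + E; rewrite -E tens_top. Qed.

Lemma monic_leq n l (x : diagram n l) : monic x -> l <= n.
Proof.
move=> /forallP xm; have h j : {a | x (inr j) = inl a}.
  by case E: (x (inr j)) (xm j) => [a|] // _; exists a.
pose f j := sval (h j); have fE j : x (inr j) = inl (f j) by exact: (svalP (h j)).
have fi : injective f.
  move=> j j' E; have := partnerK x (inr j); rewrite fE E -fE partnerK => -[->] //.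
by have := leq_card f fi; rewrite !card_ord.
Qed.

Lemma monic_id k (x : diagram k k) : monic x -> x = id_diagram k.
Proof.
elim: k x => [|k IH] x; first by move=> _; apply: diagram_eq => -[] [].
case/monic_tens_or_close => -[y ym ->].
  by rewrite (IH _ ym) tens_id.
by have := monic_leq ym; lia.
Qed.

Lemma id_monic k : monic (id_diagram k).
Proof. by apply/forallP => j; rewrite ffunE. Qed.

Lemma monic_concat_dl n l (x : diagram n l.+2) i : monic x ->
  exists2 z, concat x (dl l i) = Some z & monic z.
Proof.
move=> /forallP xm.
have inrF j q : x (inr j) = inr q -> False by move=> E; have := xm j; rewrite E.
have [|z -> Hz] := @concat_delta l (inord i) n x; first by apply/eqP => /inrF.
exists z => //; apply/forallP => k; have := Hz (inr k); rewrite /reroute.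
case E: (x (skip _ _)) => [a|b] /=; last by case: (inrF _ _ E).
by case: (z _).
Qed.

Lemma dl_monic l i : monic (dl l i).
Proof.
have [z] := @monic_concat_dl l.+2 l (id_diagram l.+2) i (id_monic _).
by rewrite concat_id_left => -[->].
Qed.

(** The reflection of [x] cannot be monic for lack of top points, so it has a cap between
    neighbours, which is a cup of [x]. *)
Lemma monic_dl_concat n l (x : diagram n.+2 l) : monic x -> l <= n ->
  exists i y, [/\ i <= n, monic y & Some x = Dl n i ** Some (y : diagram n l)].
Proof.
move=> xm ln; have nm : ~~ monic (flip x) by apply/negP => /monic_leq; lia.
have [i [z Hz]] := not_monic_concat nm.
exists i, (flip z); have il := ltn_ord i.
have E : Some x = Dl n i ** Some (flip z).
  have -> : dl n i = delta i by rewrite /dl inord_val.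
  by have := congr1 (omap (@flip _ _)) Hz; rewrite -concat_flip /= !flipK.
split=> //.
by move/esym/concat_monic: E; apply.
Qed.

Lemma monic_dl l (x : diagram l.+2 l) : monic x -> exists2 i, i <= l & x = dl l i.
Proof.
move=> xm; have [i [y [il ym]]] := monic_dl_concat xm (leqnn l).
by rewrite (monic_id ym) compl1 => -[->]; exists i.
Qed.

Lemma exists_monic q l : exists x : diagram (q.*2 + l) l, monic x.
Proof.
elim: q => [|q [x xm]]; first by exists (id_diagram l); apply: id_monic.
by exists (close (tens x)); apply: close_monic; rewrite tens_monic.
Qed.

(** The orbits of the involution [x] on the boundary points all have two elements. *)
Lemma diagram_parity n m (x : diagram n m) : ~~ odd (n + m).
Proof.
have xi : injective x by apply: inv_inj (partnerK x).
have o2 : [pred p : point n m | true] \subset order_set x 2.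
  apply/subsetP => p _; rewrite inE /order -[X in _ == X]/(2%N).
  rewrite (@eq_card _ _ (pred2 p (x p))) ?card2; first by rewrite [p == x p]eq_sym partner_neq.
  move=> q; rewrite !inE; apply/idP/idP.
    case/connectP => s; elim: s p => [|r s IH] p /=; first by move=> _ ->; rewrite eqxx.
    case/andP => /eqP <- /IH H /H; rewrite partnerK orbC => /orP[]->//.
    by rewrite orbT.
  by case/orP=> /eqP ->; [apply: connect0|apply: fconnect1].
have /= := fcard_order_set xi o2; move/(_ (fun _ _ _ => erefl)).
have -> : #|[pred p : point n m | true]| = n + m.
  by rewrite -[RHS](congr2 addn (card_ord n) (card_ord m)) -card_sum; apply: eq_card.
by move=> <-; rewrite oddM andbF.
Qed.

Local Open Scope ring_scope.

(** * The complex of standard modules *)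

Lemma big_support (V : nmodType) (I X : finType) (h : I -> X) (P : pred I) (f : X -> V) :
  {in P &, injective h} ->
  (forall x, (forall i, P i -> x <> h i) -> f x = 0) ->
  \sum_x f x = \sum_(i | P i) f (h i).
Proof.
move=> hi f0; rewrite -(big_imset f hi) [RHS]big_mkcond /=; apply: eq_bigr => x _.
case: ifP => // /negbT nx; apply: f0 => i Pi E.
by move/negP: nx; apply; apply/imsetP; exists i.
Qed.

Section Linear.
Variable F : fieldType.

Notation V n l := {ffun monic_diagram n l -> F^o}.
Notation bas := (W_basis F).

Lemma basis_None n l : bas (None : option (diagram n l)) = 0.
Proof. by apply/ffunP => z; rewrite !ffunE. Qed.

Lemma basis_not_monic n l (z : diagram n l) : ~~ monic z -> bas (Some z) = 0.
Proof.
move=> nz; apply/ffunP => x; rewrite !ffunE (inj_eq Some_inj).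
by case: eqP => // E; move: nz; rewrite E (valP x).
Qed.

Lemma basis_decomp n l (w : V n l) : w = \sum_x w x *: bas (Some (val x)).
Proof.
apply/ffunP => z; rewrite sum_ffunE (bigD1 z) //= !ffunE eqxx.
rewrite big1 ?addr0 => [|x nx]; first by rewrite /GRing.scale /= mulr1.
by rewrite !ffunE (inj_eq Some_inj) val_eqE (negPf nx) scaler0.
Qed.

Lemma linear_ext n l (U : lmodType F) (f g : {linear V n l -> U}) :
  (forall x : monic_diagram n l, f (bas (Some (val x))) = g (bas (Some (val x)))) -> f =1 g.
Proof.
move=> fg w; rewrite [w]basis_decomp !linear_sum; apply: eq_bigr => x _.
by rewrite !linearZ fg.
Qed.

Lemma extend_basis_val n l (U : lmodType F) (G : monic_diagram n l -> U) x :
  extend G (bas (Some (val x))) = G x.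
Proof. by apply: extend_basis => d; rewrite ffunE. Qed.

(** Diagrams with different numbers of top and bottom points also act, which allows induction on
    [n]; [W_scaleE] relates the case [k = n] to the algebra action. *)
Definition act k n l (o : option (diagram k n)) : V n l -> V k l :=
  extend (fun x => bas (o ** Some (val x))).

HB.instance Definition _ k n l o := GRing.isLinear.Build F (V n l) (V k l) *:%R
  (@act k n l o) (extend_is_linear _).

(* [phi] with the vector space structures of its source and target. *)
Definition phil n l : V n l.+2 -> V n l := @phi F n l.

HB.instance Definition _ n l := GRing.isLinear.Build F (V n l.+2) (V n l) *:%R
  (@phil n l) (extend_is_linear _).

Lemma comp_monic n m l (a : option (diagram n m)) (b : diagram m l) z :
  a ** Some b = Some z -> monic z -> monic b.
Proof. by case: a => //= x; apply: concat_monic. Qed.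

Lemma act_basis k n l (o : option (diagram k n)) (p : option (diagram n l)) :
  act o (bas p) = bas (o ** p).
Proof.
case: p => [z|]; last by rewrite comp_None !basis_None linear0.
case: (boolP (monic z)) => mz.
  exact: (extend_basis_val _ (exist _ z mz)).
rewrite (basis_not_monic mz) linear0; case E: (o ** Some z) => [t|]; last by rewrite basis_None.
by rewrite basis_not_monic //; apply: contra mz; apply: comp_monic E.
Qed.

Lemma act_comp k m n l (o : option (diagram k m)) (o' : option (diagram m n)) (w : V n l) :
  act o (act o' w) = act (o ** o') w.
Proof.
apply: (linear_ext (f := act o \o act o') (g := act (o ** o'))) => x /=.
by rewrite !act_basis compA.
Qed.

Lemma act_id n l (w : V n l) : act (Id n) w = w.
Proof.
apply: (linear_ext (f := act (Id n)) (g := idfun)) => x /=.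
by rewrite act_basis comp1l.
Qed.

Lemma act_None k n l (w : V n l) : act (None : option (diagram k n)) w = 0.
Proof. by rewrite /act; apply: big1 => x _; rewrite basis_None scaler0. Qed.

Lemma act_coef k n l (o : option (diagram k n)) (w : V n l) y :
  act o w y = \sum_x w x * (o ** Some (val x) == Some (val y))%:R.
Proof. by rewrite sum_ffunE; apply: eq_bigr => x _; rewrite !ffunE. Qed.

Lemma basis_gm n l (a : option (diagram n l)) j : bas (a ** Gm l j) = 0.
Proof.
case E: (_ ** _) => [z|]; last exact: basis_None.
by rewrite basis_not_monic //; apply/negP => /(comp_monic E); apply/negP/gamma_not_monic.
Qed.

Lemma basis_gm_dl_far n l (a : option (diagram n l)) i j :
  (i <= l)%N -> (j <= l)%N -> (i.+2 <= j)%N || (j.+2 <= i)%N ->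
  bas (a ** (Gm l j ** Dl l i)) = 0.
Proof.
case: l a => [|[|l]] a il jl; try lia.
case/orP => H.
  case: j jl H => [|[|j]] // jl H.
  by rewrite gm_dl_far' // -compA basis_gm.
case: i il H => [|[|i]] // il H.
by rewrite gm_dl_far // -compA basis_gm.
Qed.

Lemma phil_basis n l (o : option (diagram n l.+2)) : ~~ odd l ->
  phil (bas o) = \sum_(i < l./2.+1) (-1) ^+ i *: bas (o ** Dl l i.*2).
Proof.
move=> le; case: o => [z|]; last first.
  by rewrite basis_None linear0 big1 // => i _; rewrite basis_None scaler0.
case: (boolP (monic z)) => mz.
  exact: (extend_basis_val _ (exist _ z mz)).
rewrite (basis_not_monic mz) linear0.
have [j [x Hx]] := not_monic_concat mz; have jl := ltn_ord j.
have -> : Some z = Some x ** Gm l j by rewrite -Hx /gm inord_val.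
have le2 : l = l./2.*2 by rewrite -[LHS]odd_double_half (negPf le).
have i2 (i : 'I_l./2.+1) : (i.*2 <= l)%N by rewrite [X in (_ <= X)%N]le2 leq_double -ltnS.
(* For even [j] the cup at [j] closes a loop, and every other cup has even position too, so it
   leaves a cap. *)
case: (boolP (odd j)) => oj; last first.
  rewrite big1 // => i _; rewrite compA.
  have [E|N] := eqVneq (i.*2) j.
    by rewrite E gm_dl_same // comp_None basis_None scaler0.
  by rewrite basis_gm_dl_far ?scaler0 //; lia.
(* For odd [j] the cups at [j - 1] and [j + 1] both give back [x], with opposite signs. *)
pose q := j./2; have jq : j = q.*2.+1 :> nat by rewrite -[LHS]odd_double_half oj.
have qh : (q.+1 < l./2.+1)%N by lia.
pose q0 := Ordinal (ltnW qh); pose q1 := Ordinal qh.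
have n10 : q1 != q0 by rewrite -(inj_eq val_inj) /=; lia.
rewrite (bigD1 q0) // (bigD1 q1) //= addrA big1 ?addr0.
  rewrite !compA jq gm_dl_pred; last by lia.
  rewrite doubleS gm_dl_succ; last by lia.
  by rewrite compl1 exprS mulN1r scaleNr subrr.
move=> i /andP[n0 n1]; rewrite compA basis_gm_dl_far ?scaler0 //.
by move: n0 n1; rewrite -!(inj_eq val_inj) /=; lia.
Qed.

Lemma phil_act k n l (o : option (diagram k n)) (w : V n l.+2) : ~~ odd l ->
  phil (act o w) = act o (phil w).
Proof.
move=> le; apply: (linear_ext (f := @phil k l \o act o) (g := act o \o @phil n l)) => x /=.
rewrite act_basis !phil_basis // linear_sum; apply: eq_bigr => i _.
by rewrite linearZ /= act_basis compA.
Qed.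

(** By induction on [h]: the new column [T i h] cancels against the new row [T h.+1 i]. *)
Lemma simplicial_sum (U : lmodType F) (T : nat -> nat -> U) h :
  (forall i j, (i <= j)%N -> (j < h)%N -> T i j = T j.+1 i) ->
  \sum_(i < h.+1) \sum_(j < h) (-1) ^+ (i + j) *: T i j = 0.
Proof.
elim: h => [|h IH] HT; first by rewrite big1 // => i _; rewrite big_ord0.
rewrite big_ord_recr /=.
under eq_bigr do rewrite big_ord_recr /=.
rewrite big_split /= IH ?add0r => [|i j ij jh]; last by apply: HT => //; apply: ltnW.
rewrite -big_split /=; apply: big1 => i _; have ih : (i <= h)%N by rewrite -ltnS.
rewrite (HT _ _ ih (ltnSn h)) -scalerDl.
by rewrite addSn [X in _ ^+ X + _]addnC exprS mulN1r addrN scale0r.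
Qed.

Lemma phil_phil n l (w : V n l.+4) : ~~ odd l -> phil (phil w) = 0.
Proof.
move=> le; apply: (linear_ext (f := @phil n l \o @phil n l.+2) (g := \0)) => x /=.
rewrite phil_basis ?negbK //= linear_sum.
rewrite -[RHS](@simplicial_sum _ (fun i j => bas (Some (val x) ** Dl l.+2 i.*2 ** Dl l j.*2)) l./2.+1).
  apply: eq_bigr => i _; rewrite linearZ /= phil_basis // scaler_sumr.
  by apply: eq_bigr => j _; rewrite scalerA exprD.
move=> i j ij jl; rewrite !compA dl_dl ?leq_double ?doubleS //.
by move: jl (odd_double_half l); rewrite (negPf le); lia.
Qed.

(** * The leading term of the differential, and exactness *)

Definition mtens n l (y : monic_diagram n l) : monic_diagram n.+1 l.+1 :=
  exist _ (tens (val y)) (etrans (tens_monic (val y)) (valP y)).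

Definition mclose n l (y : monic_diagram n l.+1) : monic_diagram n.+1 l :=
  exist _ (close (val y)) (close_monic (valP y)).

Lemma mtens_inj n l : injective (@mtens n l).
Proof. by move=> y y' /(congr1 val)/tens_inj/val_inj. Qed.

Lemma mclose_inj n l : injective (@mclose n l).
Proof. by move=> y y' /(congr1 val)/close_inj/val_inj. Qed.

Lemma mtens_mclose n l (x : monic_diagram n.+1 l.+1) :
  (exists y, x = mtens y) \/ (exists y, x = mclose y).
Proof.
case: (monic_tens_or_close (valP x)) => -[y ym E]; [left|right];
  by exists (exist _ y ym); apply: val_inj.
Qed.

Lemma mclose0 n (x : monic_diagram n.+1 0) : exists y, x = mclose y.
Proof. by have [y ym E] := monic_close0 (valP x); exists (exist _ y ym); apply: val_inj. Qed.

Lemma mtens_neq n l (y : monic_diagram n l) y' : mtens y <> mclose y'.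
Proof. by move=> /(congr1 val); apply: tens_close (valP y'). Qed.

(** Only the last cup meets the added strand; all other terms keep it as a throughline and have no
    coefficient at [mclose y]. *)
Lemma phil_mtens n l (y y' : monic_diagram n l.+1) : ~~ odd l ->
  phil (bas (Some (val (mtens y')))) (mclose y) = (-1) ^+ l./2 * (y' == y)%:R.
Proof.
move=> le; have le2 : l./2.*2 = l by rewrite -[RHS]odd_double_half (negPf le).
rewrite phil_basis // sum_ffunE big_ord_recr /= big1 ?add0r => [|i _].
  rewrite le2 tens_dl_last !ffunE; congr (_ * _%:R).
  by rewrite (inj_eq Some_inj) (inj_eq (@close_inj _ _)) val_eqE.
rewrite !ffunE; case: l y y' le le2 i => [|l] y y' le le2 i; first by case: i.
have il : (i.*2 <= l)%N by have := ltn_ord i; lia.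
rewrite -[Some (tens _)]/(omap (@tens _ _) (Some (val y'))) -tens_dl //.
case: (_ ** _) => [z|] /=; last by rewrite scaler0.
case: eqP => [[/esym]|_]; last by rewrite scaler0.
by move=> E; case: (tens_close (valP y) (esym E)).
Qed.

(* The diagrams whose last top point lies on a throughline and those whose last
   top point lies on a cup are matched by the leading term of [phi]. *)
Lemma phil_mclose n l (w : V n.+1 l.+2) y : ~~ odd l ->
  (forall x, w (mclose x) = 0) -> phil w (mclose y) = (-1) ^+ l./2 * w (mtens y).
Proof.
move=> le w0; rewrite {1}[w]basis_decomp linear_sum sum_ffunE.
rewrite (bigD1 (mtens y)) //= big1 ?addr0 => [|x nx].
  by rewrite linearZ /= ffunE -[LHS]/(_ * _) phil_mtens // eqxx mulr1 mulrC.
rewrite linearZ /= ffunE -[LHS]/(_ * _).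
case: (mtens_mclose x) nx => -[x' ->] nx; last by rewrite w0 mul0r.
rewrite phil_mtens //; have [E|_] := eqVneq x' y; first by rewrite E eqxx in nx.
by rewrite !mulr0.
Qed.

Lemma phil_supported_inj n l (w : V n.+1 l.+2) : ~~ odd l ->
  (forall x, w (mclose x) = 0) -> phil w = 0 -> w = 0.
Proof.
move=> le w0 p0; apply/ffunP => x; rewrite ffunE.
case: (mtens_mclose x) => -[y ->]; last exact: w0.
have := phil_mclose y le w0; rewrite p0 ffunE => /esym/eqP.
by rewrite mulf_eq0 signr_eq0 => /eqP.
Qed.

Lemma phil_onto_mclose n l (c : V n.+1 l) : ~~ odd l ->
  exists w : V n.+1 l.+2, forall y, phil w (mclose y) = c (mclose y).
Proof.
move=> le; pose w : V n.+1 l.+2 :=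
  \sum_y ((-1) ^+ l./2 * c (mclose y)) *: bas (Some (val (mtens y))).
have wE x : w x = \sum_y ((-1) ^+ l./2 * c (mclose y)) * (mtens y == x)%:R.
  by rewrite sum_ffunE; apply: eq_bigr => y _; rewrite !ffunE (inj_eq Some_inj) -val_eqE.
exists w => y; rewrite phil_mclose // => [|x].
  rewrite wE (bigD1 y) //= eqxx mulr1 big1 ?addr0 => [|y' ny].
    by rewrite mulrA -exprD addnn -mul2n exprM sqrrN !expr1n mul1r.
  by rewrite (inj_eq (@mtens_inj _ _)) (negPf ny) mulr0.
rewrite wE big1 // => y' _; case: eqP => [E|_]; last exact: mulr0.
by case: (mtens_neq E).
Qed.

(** Given a cycle [w], some boundary agrees with it on all [mclose] diagrams. The difference is a
    cycle supported on [mtens] diagrams, hence zero. *)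
Lemma phil_exact n l (w : V n l.+2) : ~~ odd l -> (0 < n)%N ->
  phil w = 0 <-> exists v : V n l.+4, phil v = w.
Proof.
case: n w => // n w le _; split=> [p0|[v <-]]; last exact: phil_phil.
have [|v vE] := @phil_onto_mclose _ _ w; first by rewrite /= negbK.
exists v; apply/eqP; rewrite -subr_eq0; apply/eqP.
apply: phil_supported_inj => // [x|]; last by rewrite linearB /= phil_phil // p0 subr0.
by rewrite !ffunE vE subrr.
Qed.

Lemma phil_surj n (w : V n 0) : (0 < n)%N -> exists v : V n 2, phil v = w.
Proof.
case: n w => // n w _; have [//|v vE] := @phil_onto_mclose _ _ w.
by exists v; apply/ffunP => x; have [y ->] := mclose0 x.
Qed.

Lemma V_trivial n l (w : V n l) : (n < l)%N -> w = 0.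
Proof. by move=> nl; apply/ffunP => x; have := monic_leq (valP x); lia. Qed.

Lemma phil_inj l : ~~ odd l -> injective (@phil l.+2 l).
Proof.
move=> le w w' E; apply/eqP; rewrite -subr_eq0; apply/eqP.
(* The difference comes from a space of diagrams with more bottom than top points, which is zero. *)
have [|v <-] := (@phil_exact _ _ (w - w') le isT).1; first by rewrite linearB /= E subrr.
by rewrite (V_trivial v) ?linear0.
Qed.

Lemma phil_neq0 n l : ~~ odd l -> ~~ odd n -> (l.+2 <= n)%N -> exists v : V n l.+2, phil v <> 0.
Proof.
move=> le ne ln; have -> : n = (((n - l.+2)./2).*2 + l.+1).+1 by lia.
have [x xm] := exists_monic (n - l.+2)./2 l.+1.
exists (bas (Some (val (mtens (exist _ x xm))))) => /phil_supported_inj H.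
suff /ffunP/(_ (mtens (exist _ x xm))) : bas (Some (val (mtens (exist _ x xm)))) = 0.
  by rewrite !ffunE eqxx => /eqP; rewrite oner_eq0.
apply: H => // y; rewrite ffunE; case: eqP => // /Some_inj/val_inj/mtens_neq [].
Qed.

End Linear.

(** * One cap against one or two cups *)

Lemma gm_dl_near l p i : (p <= l)%N -> (i <= l)%N -> (i == p.+1) || (p == i.+1) ->
  Gm l p ** Dl l i = Id l.
Proof.
move=> pl il /orP[] /eqP E; first by rewrite E gm_dl_succ // -E.
by rewrite E gm_dl_pred // -E.
Qed.

Lemma not_monic_gm n l (a : option (diagram n l)) j z : a ** Gm l j = Some z -> ~~ monic z.
Proof. by move=> E; apply/negP => /(comp_monic E); apply/negP/gamma_not_monic. Qed.

Lemma gm_dl_far_gm l p i : (p <= l)%N -> (i <= l)%N -> (i.+2 <= p)%N || (p.+2 <= i)%N ->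
  exists2 z, Gm l p ** Dl l i = Some z & ~~ monic z.
Proof.
case: l => [|[|l]] pl il H; try lia.
have S n (x : diagram n l) j : (j <= l)%N -> exists z, Some x ** Gm l j = Some z.
  move=> jl; have [z [Hz _ _]] := @concat_gamma n l (inord j) x.
  by exists z.
case/orP: H => H.
  case: p pl H => [|[|p]] // pl H; rewrite gm_dl_far' //.
  have [//|z E] := S _ (dl l i) p; exists z => //; exact: not_monic_gm E.
case: i il H => [|[|i]] // il H; rewrite gm_dl_far //.
have [|z E] := S _ (dl l i) p; first lia.
by exists z => //; exact: not_monic_gm E.
Qed.

Lemma gm_dl_id l p i : (p <= l)%N -> (i <= l)%N ->
  (Gm l p ** Dl l i == Id l) = (i == p.+1) || (p == i.+1).
Proof.
move=> pl il; case: (boolP (_ || _)) => N; first by rewrite gm_dl_near // eqxx.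
have [->|ne] := eqVneq i p; first by rewrite gm_dl_same.
have [|z -> nz] := @gm_dl_far_gm l p i pl il; first by lia.
by apply/eqP => -[E]; move: nz; rewrite E id_monic.
Qed.

(** The cap at [i] closes a loop with the cup at [i] and with no other. *)
Lemma dl_inj l i j : (i <= l)%N -> (j <= l)%N -> dl l i = dl l j -> i = j.
Proof.
move=> il jl E; apply/eqP; apply: contraTT isT => ne.
have : Gm l i ** Dl l j = None by rewrite -E gm_dl_same.
case: (boolP ((j == i.+1) || (i == j.+1))) => N; first by rewrite gm_dl_near.
by have [|z ->] := @gm_dl_far_gm l i j il jl; first by lia.
Qed.

(** Either the cap straightens with the first cup and leaves the second, or it slides past the
    first, lying to its left or to its right, and straightens with the second. The shifts by 2 come
    from sliding. *)
Lemma gm_dl_dl l p i j s : (p <= l.+2)%N -> (i <= l.+2)%N -> (j <= l)%N -> (s <= l)%N ->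
  (Gm l.+2 p ** (Dl l.+2 i ** Dl l j) == Dl l s) =
  [|| ((i == p.+1) || (p == i.+1)) && (j == s),
      [&& p.+2 <= i, (j == p.+1) || (p == j.+1) & i == s.+2] |
      [&& i.+2 <= p, (j.+1 == p) || (p == j.+3) & i == s]]%N.
Proof.
move=> pl il jl sl; rewrite -compA.
have dlE k : (k <= l)%N -> (Dl l k == Dl l s) = (k == s).
  by move=> kl; apply/eqP/eqP => [/Some_inj/dl_inj|->//]; apply.
have farF q k r : (q <= l)%N -> (r <= l)%N -> (k <= l)%N ->
    (Dl l r ** (Gm l q ** Dl l k) == Dl l s) =
    ((k == q.+1) || (q == k.+1)) && (r == s).
  move=> ql rl kl; case: (boolP (_ || _)) => N; first by rewrite gm_dl_near // compl1 dlE.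
  have [->|ne] := eqVneq k q; first by rewrite gm_dl_same // comp_None.
  apply/negbTE/eqP => E; case: l pl il jl sl dlE ql rl kl N ne E => [|[|l]] pl il jl sl dlE ql rl kl N ne E; try lia.
  have : (q.+2 <= k)%N || (k.+2 <= q)%N by lia.
  case/orP => H.
    case: k kl N ne H E => [|[|k]] // kl N ne H; rewrite gm_dl_far // -compA => E.
    by have := not_monic_gm E; rewrite dl_monic.
  case: q ql N ne H E => [|[|q]] // ql N ne H; rewrite gm_dl_far' // -compA => E.
  by have := not_monic_gm E; rewrite dl_monic.
have [->|ne] := eqVneq i p; first by rewrite gm_dl_same // None_comp -[LHS]/false; lia.
case: (boolP ((i == p.+1) || (p == i.+1))) => N.
  by rewrite gm_dl_near // comp1l dlE //; lia.
have : (p.+2 <= i)%N || (i.+2 <= p)%N by lia.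
case/orP => H.
  case: i il ne N H => [|[|i]] // il ne N H; rewrite gm_dl_far // compA farF //; lia.
case: p pl ne N H => [|[|p]] // pl ne N H; rewrite gm_dl_far' // compA farF //; lia.
Qed.

(** A loop arises exactly over a cup between neighbours: the one at [i], and the one at [j.+2]
    unless the two cups are nested. In [dl_dl_inj] these positions recover [i] and [j]. *)
Lemma gm_dl_dl_None l p i j : (p <= l.+2)%N -> (i <= j.+1)%N -> (j <= l)%N ->
  (Gm l.+2 p ** (Dl l.+2 i ** Dl l j) == None) = (p == i) || ((i <= j)%N && (p == j.+2)).
Proof.
move=> pl ij jl; have il : (i <= l.+2)%N by lia.
rewrite -compA.
have nN q k r : (q <= l)%N -> (r <= l)%N -> (k <= l)%N ->
    (Dl l r ** (Gm l q ** Dl l k) == None) = (k == q).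
  move=> ql rl kl; have [->|ne] := eqVneq k q; first by rewrite gm_dl_same.
  case: (boolP ((k == q.+1) || (q == k.+1))) => N; first by rewrite gm_dl_near // compl1.
  case: l pl il jl ql rl kl N ne => [|[|l]] pl il jl ql rl kl N ne; try lia.
  have S n (x : diagram n l) t : exists z, Some x ** Gm l t = Some z.
    by have [z [Hz _ _]] := @concat_gamma n l (inord t) x; exists z.
  have D t u : exists z, Dl l.+2 t ** Dl l u = Some z.
    by have [z Hz _] := monic_concat_dl u (dl_monic l.+2 t); exists z.
  have : (q.+2 <= k)%N || (k.+2 <= q)%N by lia.
  case/orP => H.
    case: k kl N ne H => [|[|k]] // kl N ne H; rewrite gm_dl_far // -compA.
    by have [z ->] := D r k; have [z' ->] := S _ z q.
  case: q ql N ne H => [|[|q]] // ql N ne H; rewrite gm_dl_far' // -compA.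
  by have [z ->] := D r k; have [z' ->] := S _ z q.
have [->|ne] := eqVneq i p; first by rewrite gm_dl_same // None_comp !eqxx.
case: (boolP ((i == p.+1) || (p == i.+1))) => N.
  by rewrite gm_dl_near // comp1l -[LHS]/false; lia.
have : (p.+2 <= i)%N || (i.+2 <= p)%N by lia.
case/orP => H.
  case: i ij il ne N H => [|[|i]] // ij il ne N H; rewrite gm_dl_far // compA nN //; lia.
case: p pl ne N H => [|[|p]] // pl ne N H; rewrite gm_dl_far' // compA nN //; lia.
Qed.

Lemma monic_dl_dl l (x : diagram l.+4 l) : monic x ->
  exists i j, [/\ (i <= j.+1)%N, (j <= l)%N & Some x = Dl l.+2 i ** Dl l j].
Proof.
move=> xm; have [|i [y [il ym E]]] := monic_dl_concat xm; first lia.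
have [j jl yE] := monic_dl ym; rewrite {}yE {ym y} in E.
have [ij|ij] := leqP i j.+1; first by exists i, j.
case: i il ij E => [|[|i]] // il ij E.
exists j, i; split; [lia|lia|].
by rewrite E -dl_dl //; lia.
Qed.

Lemma dl_dl_inj l i j i' j' : (i <= j.+1)%N -> (j <= l)%N -> (i' <= j'.+1)%N -> (j' <= l)%N ->
  Dl l.+2 i ** Dl l j = Dl l.+2 i' ** Dl l j' -> i = i' /\ j = j'.
Proof.
move=> ij jl ij' jl' E.
have H p : (p <= l.+2)%N -> (p == i) || ((i <= j)%N && (p == j.+2)) =
    (p == i') || ((i' <= j')%N && (p == j'.+2)).
  by move=> pl; rewrite -(@gm_dl_dl_None l) // E gm_dl_dl_None.
have := H i; have := H i'; have := H j.+2; have := H j'.+2; lia.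
Qed.

(** * The linear equations satisfied by a vector killed by all caps *)

Section Radical.
Variable F : fieldType.
Notation V n l := {ffun monic_diagram n l -> F^o}.

Lemma pick1 N (A : nat -> F) k : (forall i, (N <= i)%N -> A i = 0) ->
  \sum_(i < N) A i * (i == k :> nat)%:R = A k.
Proof.
move=> A0; have [kN|kN] := ltnP k N.
  rewrite (bigD1 (Ordinal kN)) //= eqxx mulr1 big1 ?addr0 // => i ni.
  by rewrite (negPf (_ : i != k :> nat)) ?mulr0 // -[k]/(val (Ordinal kN)) (inj_eq val_inj).
rewrite A0 // big1 // => i _; have := ltn_ord i => iN.
by rewrite (negPf (_ : i != k :> nat)) ?mulr0 //; lia.
Qed.

Definition normal l i j := (i <= j.+1)%N && (j <= l)%N.

Lemma pick2 l (A : nat -> nat -> F) i0 j0 : (forall i j, ~~ normal l i j -> A i j = 0) ->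
  \sum_(i < l.+2) \sum_(j < l.+1) A i j * ((i == i0 :> nat) && (j == j0 :> nat))%:R = A i0 j0.
Proof.
move=> A0.
rewrite -[RHS](@pick1 l.+1 (A i0)) => [|j lj]; last by apply: A0; rewrite /normal; lia.
rewrite exchange_big; apply: eq_bigr => j _ /=.
rewrite -[A i0 j](@pick1 l.+2 (A^~ j)) => [|i li]; last first.
  by apply: A0; rewrite /normal; have := ltn_ord j; lia.
by rewrite mulr_suml; apply: eq_bigr => i _; rewrite -mulrA -natrM mulnb.
Qed.

Lemma pick3 l (A : nat -> nat -> F) (b : nat -> nat -> bool) i1 j1 i2 j2 i3 j3 :
  (forall i j, ~~ normal l i j -> A i j = 0) ->
  (forall i j, normal l i j -> b i j = ((i == i1) && (j == j1)) + ((i == i2) && (j == j2))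
      + ((i == i3) && (j == j3)) :> nat)%N ->
  \sum_(i < l.+2) \sum_(j < l.+1) A i j * (b i j)%:R = A i1 j1 + A i2 j2 + A i3 j3.
Proof.
move=> A0 bE; rewrite -(@pick2 l A i1 j1) // -(@pick2 l A i2 j2) // -(@pick2 l A i3 j3) //.
rewrite -!big_split /=; apply: eq_bigr => i _; rewrite -!big_split /=; apply: eq_bigr => j _.
have [nij|/A0->] := boolP (normal l i j); last by rewrite !mul0r !addr0.
by rewrite bE // !natrD !mulrDr.
Qed.

(* The coefficients are indexed as in [dl_dl]: [A i j] belongs to the diagram
   [dl l.+2 i ** dl l j], and the diagrams with nested cups are those with
   [i = j.+1].  The recurrences force all coefficients to be multiples of [A 0 1],
   and the last one reads [(l + 3) / 2 * A 0 1 = 0]. *)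
Lemma two_cup_system l (A : nat -> nat -> F) : odd l -> [pchar F] =i pred0 ->
  (forall i j, ~~ normal l i j -> A i j = 0) ->
  (forall s q, (s <= q)%N -> (q < l)%N -> A s q + A s q.+2 = 0) ->
  A 1%N 0%N + A 0%N 1%N = 0 ->
  (forall s, (s < l)%N -> A s.+2 s.+1 + A s.+1 s.+2 + A s.+1 s = 0) ->
  (forall s, (0 < s)%N -> (s <= l)%N -> A 1%N s = 0) ->
  (forall q s, (q.+2 <= s)%N -> (s <= l)%N -> A q s + A q.+2 s = 0) ->
  (forall q, (q < l)%N -> A q q.+1 + A q.+2 q.+1 + A q.+3 q.+2 = 0) ->
  forall i j, A i j = 0.
Proof.
move=> ol ch A0 E1 E20 E2 E30 E3 E4.
have opp (x y : F) : x + y = 0 -> y = - x by move=> /eqP; rewrite addrC addr_eq0 => /eqP.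
(* For cups that are not nested, an odd first index is eliminated upwards from 1, and an even second
   index downwards from beyond the range, as [l] is odd. *)
have Aodd t j : (t.*2.+1 <= j)%N -> A t.*2.+1 j = 0.
  elim: t => [|t IH] tj.
    have [jl|jl] := leqP j l; last by apply: A0; rewrite /normal; lia.
    by apply: E30 => //; lia.
  have [jl|jl] := leqP j l; last by apply: A0; rewrite /normal; lia.
  rewrite doubleS in tj *; have := E3 t.*2.+1 j; rewrite IH; last lia.
  by rewrite add0r; apply; lia.
have Aeven s k : forall j, (s <= j)%N -> ~~ odd j -> (l - j <= k)%N -> A s j = 0.
  elim: k => [|k IH] j sj ej ljk; first by apply: A0; rewrite /normal; lia.
  have [jl|jl] := ltnP j l; last by apply: A0; rewrite /normal; lia.
  have := E1 s j sj jl; rewrite (IH j.+2) ?addr0 //; rewrite ?negbK //; lia.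
pose a := A 0%N 1%N.
have Aa t : (t.*2 < l)%N -> A t.*2 t.*2.+1 = a.
  elim: t => [//|t IH] tl; rewrite doubleS in tl *.
  have := E3 t.*2 t.*2.+3; have := E1 t.*2 t.*2.+1; rewrite IH; last lia.
  move=> H1 H2; rewrite (opp _ _ (H2 _ _)) ?(opp _ _ (H1 _ _)) ?opprK //; lia.
(* For nested cups the multiple of [a] grows by one every two steps. *)
have B t : (t.*2 < l)%N -> A t.*2.+1 t.*2 = - (t.+1%:R * a) /\ A t.*2.+2 t.*2.+1 = t.+1%:R * a.
  elim: t => [|t IH] tl.
    have B0 : A 1%N 0%N = - a by rewrite (opp _ _ (etrans (addrC _ _) E20)).
    split; first by rewrite mul1r.
    have := E2 0%N; rewrite B0 (Aodd 0%N) // addr0 mul1r => H.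
    by apply/eqP; rewrite -subr_eq0; apply/eqP; apply: H; lia.
  rewrite doubleS in tl *; have [|_ B1] := IH; first lia.
  have := E2 t.*2.+1; rewrite B1 -doubleS Aa; last by rewrite doubleS; lia.
  move=> H; have {}H : A t.+1.*2.+1 t.+1.*2 + a + t.+1%:R * a = 0 by rewrite doubleS; apply: H; lia.
  have B2 : A t.+1.*2.+1 t.+1.*2 = - (t.+2%:R * a).
    by apply/eqP; rewrite -addr_eq0 -[t.+2]addn1 natrD mulrDl mul1r [_ * a + a]addrC addrA H.
  split=> //; have := E2 t.+1.*2; rewrite B2 (Aodd t.+1 t.+1.*2.+2) ?addr0 //.
  move=> H'; apply/eqP; rewrite -subr_eq0; apply/eqP; apply: H'.
  by rewrite doubleS; lia.
have a0 : a = 0.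
  have lE : l = l./2.*2.+1 by rewrite -[LHS]odd_double_half ol.
  (* At [q = l - 1] the third term of [E4] is out of range; the others are [a] and [(l + 1) / 2]
     times [a]. Characteristic 0 then gives [a = 0]. *)
  have := E4 l./2.*2; rewrite (A0 _ l./2.*2.+2); last by rewrite /normal; lia.
  have [|_ ->] := B l./2; first lia.
  rewrite Aa; last lia.
  rewrite addr0 => H; have : l./2.+2%:R * a = 0.
    by rewrite -[l./2.+2]addn1 natrD mulrDl mul1r addrC H //; lia.
  move/eqP; rewrite mulf_eq0 => /orP[|/eqP//].
  by rewrite ((pcharf0P F).1 ch).
have AA t k : (t.*2.+1 + k.*2 <= l)%N -> A t.*2 (t.*2.+1 + k.*2)%N = 0.
  elim: k => [|k IH] tk; first by rewrite double0 addn0 Aa ?a0 //; lia.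
  rewrite doubleS !addnS in tk *; have := E1 t.*2 (t.*2.+1 + k.*2)%N.
  rewrite IH ?add0r; last lia.
  by apply; lia.
move=> i j; have [/andP[ij jl]|/A0//] := boolP (normal l i j).
have Bz t : (t.*2 < l)%N -> A t.*2.+1 t.*2 = 0 /\ A t.*2.+2 t.*2.+1 = 0.
  by move=> /B; rewrite a0 mulr0 oppr0.
have [i_odd|i_even] := boolP (odd i).
  have iE : i = i./2.*2.+1 by rewrite -[LHS]odd_double_half i_odd.
  have [le_ij|lt_ji] := leqP i j; first by rewrite {1}iE Aodd // -iE.
  have -> : j = i./2.*2 by lia.
  by rewrite {1}iE; apply: (Bz _ _).1; lia.
have iE : i = i./2.*2 by rewrite -[LHS]odd_double_half (negPf i_even).
have [le_ij|lt_ji] := leqP i j; last first.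
  case E: (i./2) iE => [|t] iE; first by lia.
  have -> : j = t.*2.+1 by lia.
  by rewrite iE doubleS; apply: (Bz _ _).2; lia.
have [j_odd|j_even] := boolP (odd j); last exact: (Aeven _ (l - j)%N).
have -> : j = (i./2.*2.+1 + (j - i)./2.*2)%N by lia.
by rewrite {1}iE AA //; lia.
Qed.

End Radical.

(** * Vectors killed by all caps *)

Definition mdl l i : monic_diagram l.+2 l := exist _ (dl l i) (dl_monic l i).
Definition mid l : monic_diagram l l := exist _ (id_diagram l) (id_monic l).

Lemma mddl_exists l i j : exists z : monic_diagram l.+4 l,
  Some (val z) = Dl l.+2 i ** Dl l j.
Proof. by have [z Hz zm] := monic_concat_dl j (dl_monic l.+2 i); exists (exist _ z zm). Qed.

Definition mddl l i j := sval (cid (mddl_exists l i j)).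

Lemma mddlE l i j : Some (val (mddl l i j)) = Dl l.+2 i ** Dl l j.
Proof. exact: svalP (cid (mddl_exists l i j)). Qed.

Section Radical.
Variable F : fieldType.
Hypothesis F0 : [pchar F] =i pred0.
Notation V n l := {ffun monic_diagram n l -> F^o}.

Lemma act_coef_one l (u : V l.+2 l) p : (p <= l)%N ->
  act (Gm l p) u (mid l) =
  \sum_(i < l.+1) u (mdl l i) * ((i == p.+1 :> nat) || (p == i.+1))%:R.
Proof.
move=> pl; rewrite act_coef.
rewrite (@big_support _ 'I_l.+1 _ (fun i => mdl l i) xpredT).
- by apply: eq_bigr => i _; rewrite /= gm_dl_id // -ltnS.
- by move=> i j _ _ /(congr1 val) E; apply: val_inj; apply: dl_inj E; rewrite -ltnS.
move=> x nx; have [i il xi] := monic_dl (valP x).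
by case: (nx (inord i)) => //; apply: val_inj; rewrite /= inordK.
Qed.

(** The equations say that the coefficients at [p - 1] and [p + 1] sum to 0. Odd positions vanish
    upwards from 1, even ones downwards from [l + 1], where the coefficient is 0 by convention. *)
Lemma one_cup_radical l (u : V l.+2 l) : odd l ->
  (forall p, (p <= l)%N -> act (Gm l p) u = 0) -> u = 0.
Proof.
move=> ol H; pose A i := if (i <= l)%N then u (mdl l i) else 0.
have A0 i : (l.+1 <= i)%N -> A i = 0 by rewrite /A; case: leqP => //; lia.
have E p : (p <= l)%N -> A p.+1 + (if p is q.+1 then A q else 0) = 0.
  move=> pl; have := act_coef_one u pl; rewrite H // ffunE => sum0; rewrite [RHS]sum0 {sum0}.
  rewrite -(@pick1 _ l.+1 A p.+1) //.
  have -> : (if p is q.+1 then A q else 0) = \sum_(i < l.+1) A i * (p == i.+1)%:R.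
    case: p {pl} => [|p]; first by rewrite big1 // => i _; rewrite mulr0.
    by rewrite -(@pick1 _ l.+1 A p) //; apply: eq_bigr => i _; rewrite eqSS eq_sym.
  rewrite -big_split; apply: eq_bigr => i _ /=.
  rewrite -mulrDr -natrD /A -ltnS ltn_ord; congr (_ * _%:R).
  by lia.
have Aodd t : A t.*2.+1 = 0.
  elim: t => [|t IH]; first by have := E 0%N; rewrite addr0; apply; lia.
  have [tl|tl] := leqP t.*2.+2 l; last by apply: A0; rewrite doubleS; lia.
  by have := E _ tl; rewrite IH addr0 doubleS.
have Aeven k : forall j, ~~ odd j -> (l - j <= k)%N -> A j = 0.
  elim: k => [|k IH] j ej ljk; first by apply: A0; lia.
  have [jl|jl] := ltnP j l; last by apply: A0; lia.
  by have := E _ jl; rewrite IH ?add0r //= ?negbK //; lia.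
apply/ffunP => x; rewrite ffunE; have [i il xi] := monic_dl (valP x).
have -> : x = mdl l i by apply: val_inj.
suff : A i = 0 by rewrite /A il.
have [oi|ei] := boolP (odd i); last exact: (Aeven (l - i)%N).
by rewrite -(odd_double_half i) oi Aodd.
Qed.

Lemma act_coef_two l (u : V l.+4 l) p s : (p <= l.+2)%N -> (s <= l)%N ->
  act (Gm l.+2 p) u (mdl l s) =
  \sum_(i < l.+2) \sum_(j < l.+1) (if normal l i j then u (mddl l i j) else 0) *
   ([|| ((i == p.+1 :> nat) || (p == i.+1)) && (j == s :> nat),
      [&& p.+2 <= i, (j == p.+1 :> nat) || (p == j.+1) & i == s.+2 :> nat] |
      [&& i.+2 <= p, (j.+1 == p) || (p == j.+3) & i == s :> nat]]%N)%:R.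
Proof.
move=> pl sl; rewrite act_coef pair_big /=.
rewrite (@big_support _ ('I_l.+2 * 'I_l.+1)%type _ (fun t => mddl l t.1 t.2)
  (fun t => normal l t.1 t.2)).
- rewrite [LHS]big_mkcond /=; apply: eq_bigr => -[i j] _ /=.
  case: ifP => [/andP[ij jl]|_]; last by rewrite mul0r.
  by rewrite mddlE gm_dl_dl //; have := ltn_ord i; lia.
- move=> [i j] [i' j'] /andP[/= ij jl] /andP[/= ij' jl'] E.
  have {}E : Dl l.+2 i ** Dl l j = Dl l.+2 i' ** Dl l j' by rewrite -!mddlE [mddl _ _ _]E.
  have [Ei Ej] := dl_dl_inj ij jl ij' jl' E.
  by congr pair; apply: val_inj.
move=> x nx; have [i [j [ij jl xE]]] := monic_dl_dl (valP x).
have il : (i < l.+2)%N by lia.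
case: (nx (Ordinal il, Ordinal (jl : (j < l.+1)%N))); first exact/andP.
by apply: val_inj; apply: Some_inj; rewrite mddlE.
Qed.

Lemma two_cup_radical l (u : V l.+4 l) : odd l ->
  (forall p, (p <= l.+2)%N -> act (Gm l.+2 p) u = 0) -> u = 0.
Proof.
move=> ol H; pose A i j := if normal l i j then u (mddl l i j) else 0.
have A0 i j : ~~ normal l i j -> A i j = 0 by rewrite /A => /negPf->.
have E p s i1 j1 i2 j2 i3 j3 : (p <= l.+2)%N -> (s <= l)%N ->
  (forall i j, normal l i j ->
   [|| ((i == p.+1 :> nat) || (p == i.+1)) && (j == s :> nat),
      [&& p.+2 <= i, (j == p.+1 :> nat) || (p == j.+1) & i == s.+2 :> nat] |
      [&& i.+2 <= p, (j.+1 == p) || (p == j.+3) & i == s :> nat]]%N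
   = ((i == i1) && (j == j1)) + ((i == i2) && (j == j2)) + ((i == i3) && (j == j3)) :> nat)%N ->
  A i1 j1 + A i2 j2 + A i3 j3 = 0.
  move=> pl sl HE; rewrite -(pick3 A0 HE) -(act_coef_two u pl sl) H //.
  by rewrite ffunE.
(* The pair [(2, 0)] is not normal; it pads equations with fewer than three terms. *)
have A20 : A 2%N 0%N = 0 by apply: A0.
have Az : forall i j, A i j = 0.
  apply: (two_cup_system ol F0 A0).
  - move=> s q sq ql; have := @E q.+3 s s q s q.+2 2%N 0%N; rewrite A20 addr0; apply; try lia.
    by move=> i j /andP[]; lia.
  - have := @E 2%N 0%N 1%N 0%N 0%N 1%N 2%N 0%N; rewrite A20 addr0; apply; try lia.
    by move=> i j /andP[]; lia.
  - move=> s sl; apply: (@E s.+3 s.+1); try lia.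
    by move=> i j /andP[]; lia.
  - move=> s s0 sl; have := @E 0%N s 1%N s 2%N 0%N 2%N 0%N; rewrite A20 !addr0; apply; try lia.
    by move=> i j /andP[]; lia.
  - move=> q s qs sl; have := @E q.+1 s q s q.+2 s 2%N 0%N; rewrite A20 addr0; apply; try lia.
    by move=> i j /andP[]; lia.
  - move=> q ql; apply: (@E q.+1 q.+1); try lia.
    by move=> i j /andP[]; lia.
apply/ffunP => x; rewrite ffunE; have [i [j [ij jl xE]]] := monic_dl_dl (valP x).
have -> : x = mddl l i j by apply: val_inj; apply: Some_inj; rewrite mddlE.
by have := Az i j; rewrite /A /normal ij jl.
Qed.

(** A cap away from the last top point turns no [mtens] diagram into an [mclose] one, so the
    [mclose] coefficients evolve on their own. *)
Lemma act_gm_mclose n l (u : V n.+3 l) i y : (i <= n)%N ->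
  act (Gm n.+1 i) u (mclose y) = act (Gm n i) [ffun z : monic_diagram n.+2 l.+1 => u (mclose z)] y.
Proof.
move=> il; rewrite !act_coef (@big_support _ _ _ (@mclose n.+2 l) xpredT).
- apply: eq_bigr => x _; rewrite ffunE; congr (_ * _%:R).
  rewrite -[Some (val (mclose x))]/(omap (@close _ _) (Some (val x))) gm_close //.
  rewrite -[Some (val (mclose y))]/(omap (@close _ _) (Some (val y))).
  by rewrite (inj_eq (inj_omap (@close_inj _ _))).
- by move=> x x' _ _; apply: mclose_inj.
case: l u y => [|l] u y x nx; first by have [z E] := mclose0 x; case: (nx z).
case: (mtens_mclose x) => -[z E]; last by case: (nx z).
rewrite {}E; rewrite -[Some (val (mtens z))]/(omap (@tens _ _) (Some (val z))) -tens_gm //.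
case: (_ ** _) => [t|]; last by rewrite mulr0.
case: eqP => [/Some_inj E|_]; last by rewrite mulr0.
by case: (tens_close (valP y) E).
Qed.

(** A cap can join the cup at the last top point to a throughline, so [mclose] diagrams may
    contribute to [mtens] coefficients; here they are assumed absent. *)
Lemma act_gm_mtens n l (u : V n.+3 l.+1) i y : (i <= n)%N -> (forall z, u (mclose z) = 0) ->
  act (Gm n.+1 i) u (mtens y) = act (Gm n i) [ffun z : monic_diagram n.+2 l => u (mtens z)] y.
Proof.
move=> il u0; rewrite !act_coef (@big_support _ _ _ (@mtens n.+2 l) xpredT).
- apply: eq_bigr => x _; rewrite ffunE; congr (_ * _%:R).
  rewrite -[Some (val (mtens x))]/(omap (@tens _ _) (Some (val x))) -tens_gm //.
  rewrite -[Some (val (mtens y))]/(omap (@tens _ _) (Some (val y))).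
  by rewrite (inj_eq (inj_omap (@tens_inj _ _))).
- by move=> x x' _ _; apply: mtens_inj.
move=> x nx; case: (mtens_mclose x) => -[z E]; first by case: (nx z).
by rewrite E u0 mul0r.
Qed.

(* The cups meeting the last top point are removed by induction on [n]; this leaves
   two cases with [l] odd. *)
Lemma caps_radical n l (u : V n.+2 l) : odd n = odd l -> (n = l /\ odd l) \/ (l.+2 <= n)%N ->
  (forall i, (i <= n)%N -> act (Gm n i) u = 0) -> u = 0.
Proof.
elim: n l u => [|n IH] l u par; first by case=> [[E ol]|//]; exfalso; rewrite -E in ol.
move=> nl H; case: (n.+1 =P l) => [E|N].
  by case: l / E u par nl H => u par nl H; apply: one_cup_radical => //; lia.
have [/andP[/eqP E ol]|nE] := boolP ((n.+1 == l.+2) && odd l).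
  by case: E => E; subst n; apply: two_cup_radical.
(* The induction is applied with [l.+1] bottom points. If [n.+1 = l.+2], then [l] is even and its
   first alternative holds; otherwise parity gives [l.+3 <= n]. *)
have u0 y : u (mclose y) = 0.
  suff /ffunP/(_ y) : [ffun z : monic_diagram n.+2 l.+1 => u (mclose z)] = 0 by rewrite !ffunE.
  apply: IH => [||i il]; [by move: par => /=; lia|lia|].
  by apply/ffunP => z; rewrite -act_gm_mclose // H ?ffunE // leqW.
case: l u par nl H N nE u0 => [|l] u par nl H N nE u0; apply/ffunP => x; rewrite ffunE.
  by have [y ->] := mclose0 x.
case: (mtens_mclose x) => -[y ->] //.
suff /ffunP/(_ y) : [ffun z : monic_diagram n.+2 l => u (mtens z)] = 0 by rewrite !ffunE.
apply: IH => [||i il]; [by move: par => /=; lia|lia|].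
by apply/ffunP => z; rewrite -act_gm_mtens // H ?ffunE // leqW.
Qed.

(** By induction on [q], such a vector is killed by every cap, since a diagram followed by a cap is
    again a diagram or zero; [caps_radical] concludes. *)
Lemma through_radical l q (u : V (q.*2 + l.+2) l) : ~~ odd l ->
  (forall d : diagram l.+2 (q.*2 + l.+2), act (Some d) u = 0) -> u = 0.
Proof.
move=> le; elim: q u => [|q IH] u H; first by rewrite -[u]act_id H.
apply: (@caps_radical (q.*2 + l.+2)) => [||i il]; [by rewrite oddD odd_double /= negbK|right; lia|].
apply: IH => d; rewrite act_comp.
by case: (_ ** _) => [z|]; [exact: H|exact: act_None].
Qed.

Lemma phil_radical n l (v : V n l.+2) : ~~ odd l -> ~~ odd n -> (l.+2 <= n)%N ->
  (forall d : diagram l.+2 n, act (Some d) v = 0) -> phil v = 0.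
Proof.
move=> le ne ln; have E : n = (((n - l.+2)./2).*2 + l.+2)%N by lia.
move: ((n - l.+2)./2) E => q E; rewrite {}E in v *.
by move=> H; apply: through_radical => // d; rewrite -phil_act // H linear0.
Qed.

End Radical.

(** * Irreducible modules *)

Section ImageModules.
Variable A : nzRingType.

(** As the kernels agree, a set-theoretic section of [g] followed by [f] is linear and bijective
    onto the image. *)
Lemma image_module_iso (U V W : lmodType A) (g : {linear U -> V}) (f : {linear U -> W}) :
  (forall v, exists u, g u = v) -> (forall u, g u = 0 <-> f u = 0) ->
  isomorphic_modules V (image_module f).
Proof.
move=> gsurj gf; pose s v := sval (cid (gsurj v)).
have gs v : g (s v) = v by exact: svalP (cid (gsurj v)).
have eqfg u u' : g u = g u' <-> f u = f u'.
  split=> /eqP; rewrite -subr_eq0 -linearB => /eqP/gf; rewrite linearB => /eqP;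
    by rewrite subr_eq0 => /eqP.
have im u : in_image f (f u) by apply/asboolP; exists u.
pose h v : image_module f := ImageModule (im (s v)).
have hl : linear h.
  move=> a v w; apply: val_inj; rewrite linearP /= -linearP; apply/eqfg.
  by rewrite linearP !gs.
pose H : {linear V -> image_module f} := HB.pack h (GRing.isLinear.Build A V (image_module f) *:%R h hl).
have pre (i : image_module f) : exists u, f u = image_val i by exact/asboolP/image_valP.
exists H; exists (fun i => g (sval (cid (pre i)))).
  move=> v; rewrite -[RHS]gs; apply/eqfg; exact: svalP (cid (pre (h v))).
move=> i; apply: val_inj; apply: etrans (svalP (cid (pre i))).
by apply/eqfg; rewrite gs.
Qed.

End ImageModules.

Section TLModules.
Variables (F : fieldType) (n : nat).
Notation TLn := (TL F n).
Notation Wn l := (W F n l).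

Lemma W_scaleE l (a : TLn) (w : Wn l) : a *: w = \sum_d a d *: act (Some d) w :> {ffun _ -> F^o}.
Proof. by []. Qed.

Lemma phi_is_linear l : ~~ odd l -> linear (@phi F n l).
Proof.
move=> le a w v; rewrite -![phi _]/(phil _).
have -> : phil (a *: w + v) = phil (a *: w) + phil v by exact: linearD.
congr (_ + _); rewrite !W_scaleE linear_sum; apply: eq_bigr => d _.
by rewrite linearZ /= phil_act.
Qed.

Definition phi_hom l (le : ~~ odd l) : Wn l.+2 -> Wn l := @phi F n l.

HB.instance Definition _ l (le : ~~ odd l) := GRing.isLinear.Build TLn (Wn l.+2) (Wn l) *:%R
  (phi_hom le) (phi_is_linear le).

(** This allows a family of linear maps indexed by all [l]; at odd [l] the zero map is taken. *)
Lemma phi_hom_exists l : exists g : {linear Wn l.+2 -> Wn l}, ~~ odd l -> forall w, g w = phi w.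
Proof.
have [le|lo] := boolP (~~ odd l); last by exists \0.
by exists (phi_hom le).
Qed.

Lemma TL_basis_scaleW l (o : option (diagram n n)) (w : Wn l) : TL_basis F o *: w = act o w.
Proof.
rewrite W_scaleE; case: o => [d|]; last first.
  by rewrite act_None; apply: big1 => d _; rewrite ffunE scale0r.
rewrite (bigD1 d) //= ffunE eqxx scale1r big1 ?addr0 // => d' nd.
by rewrite ffunE (inj_eq Some_inj) eq_sym (negPf nd) scale0r.
Qed.

Lemma W_scaleZ l (k : F) (b : TLn) (v w : Wn l) : b *: v = w ->
  (k *: b) *: v = k *: (w : {ffun monic_diagram n l -> F^o}).
Proof.
by move=> <-; rewrite !W_scaleE scaler_sumr; apply: eq_bigr => e _; rewrite ffunE scalerA.
Qed.

Lemma TL_decomp (a : TLn) : a = \sum_d a d *: TL_basis F (Some d).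
Proof.
apply/ffunP => z; rewrite sum_ffunE (bigD1 z) //= !ffunE eqxx.
rewrite big1 ?addr0 => [|x nx]; first by rewrite /GRing.scale /= mulr1.
by rewrite !ffunE (inj_eq Some_inj) (negPf nx) scaler0.
Qed.

Lemma TL_basisM (o o' : option (diagram n n)) : TL_basis F o * TL_basis F o' = TL_basis F (o ** o').
Proof.
have b0 : TL_basis F (None : option (diagram n n)) = 0 by apply/ffunP => z; rewrite !ffunE.
have B (V : lmodType F) (G : diagram n n -> V) x : extend G (TL_basis F (Some x)) = G x.
  by apply: extend_basis => y; rewrite ffunE.
case: o => [x|]; last by rewrite b0 mul0r.
case: o' => [y|]; last by rewrite comp_None b0 mulr0.
by rewrite -[LHS]/(TL_mul _ _) /TL_mul !B.
Qed.

Lemma TL_basis1 : TL_basis F (Id n) = 1. Proof. by []. Qed.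

(** On an abstract module the field acts only through the algebra. *)
Lemma scale_TL (V : lmodType TLn) (k : F) (b : TLn) (v : V) : (k *: b) *: v = k%:A *: (b *: v).
Proof. by rewrite scalerA mulr_algl. Qed.

Lemma act_end k (w : Wn k) (d : diagram k n) :
  exists c : F, act (Some d) w = c *: W_basis F (Id k).
Proof.
exists (act (Some d) w (mid k)); apply/ffunP => x.
have -> : x = mid k by apply: val_inj; apply: monic_id (valP x).
by rewrite !ffunE eqxx /GRing.scale /= mulr1.
Qed.

Lemma W_cyclic k (v : Wn k) (d : diagram k n) : act (Some d) v <> 0 ->
  forall w : Wn k, exists a : TLn, a *: v = w.
Proof.
have [c E] := act_end v d; rewrite E => N w.
have c0 : c != 0 by apply/eqP => c0; apply: N; rewrite c0 scale0r.
exists (\sum_x (w x / c) *: TL_basis F (Some (val x) ** Some d)).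
rewrite scaler_suml [RHS]basis_decomp; apply: eq_bigr => x _.
rewrite (W_scaleZ _ (TL_basis_scaleW _ _)).
rewrite -act_comp E linearZ /= act_basis compl1 scalerA.
by rewrite mulfVK.
Qed.

Definition kills k (V : lmodType TLn) : Prop :=
  forall (x : diagram n k) (d : diagram k n) (v : V), TL_basis F (Some x ** Some d) *: v = 0.

Lemma kills_iso k (U V : lmodType TLn) : isomorphic_modules U V -> kills k U <-> kills k V.
Proof.
case=> g [h hK gK]; split=> K x d v.
  by rewrite -[v]gK -linearZ K linear0.
by apply: (can_inj hK); rewrite linearZ /= K linear0.
Qed.

End TLModules.

(** * Maps from standard modules to an arbitrary module *)

Section StandardMap.
Variables (F : fieldType) (n k : nat) (d : diagram k n).
Notation TLn := (TL F n).
Notation V n l := {ffun monic_diagram n l -> F^o}.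

Definition post_comp (w : V n k) : TLn :=
  extend (fun y : monic_diagram n k => TL_basis F (Some (val y) ** Some d)) w.

HB.instance Definition _ := GRing.isLinear.Build F (V n k) TLn *:%R post_comp (extend_is_linear _).

Lemma post_comp_basis (z : monic_diagram n k) :
  post_comp (W_basis F (Some (val z))) = TL_basis F (Some (val z) ** Some d).
Proof. exact: extend_basis_val. Qed.

End StandardMap.

Section Simple.
Variables (F : fieldType) (n : nat).
Hypotheses (F0 : [pchar F] =i pred0) (n_gt0 : (0 < n)%N) (n_even : ~~ odd n).
Notation TLn := (TL F n).
Notation Wn l := (W F n l).
Variable f : forall l, {linear Wn l.+2 -> Wn l}.
Hypothesis fE : forall l, ~~ odd l -> forall w, f l w = phi w.

Lemma detect l (v : Wn l.+2) : ~~ odd l -> (l.+2 <= n)%N -> f l v <> 0 ->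
  exists d : diagram l.+2 n, act (Some d) v <> 0.
Proof.
move=> le ln N; apply: contrapT => no; apply: N; rewrite fE //.
apply: (phil_radical F0 le n_even ln) => d; apply: contrapT => N.
by apply: no; exists d.
Qed.

Lemma f_neq0 l : ~~ odd l -> (l.+2 <= n)%N -> exists v : Wn l.+2, f l v <> 0.
Proof. by move=> le ln; have [v N] := phil_neq0 F le n_even ln; exists v; rewrite fE. Qed.

Lemma f_cyclic l (v : Wn l.+2) : ~~ odd l -> (l.+2 <= n)%N -> f l v <> 0 ->
  forall w : Wn l.+2, exists a : TLn, a *: v = w.
Proof. by move=> le ln /(detect le ln)[d] /W_cyclic. Qed.

Lemma image_irreducible l : ~~ odd l -> (l.+2 <= n)%N -> irreducible_module (image_module (f l)).
Proof.
move=> le ln; have im u : in_image (f l) (f l u) by apply/asboolP; exists u.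
split.
  have [v N] := f_neq0 le ln; exists (ImageModule (im v)).
  by apply/eqP => /(congr1 val).
move=> S Ssub; have [S0|nS0] := pselect (forall v, v \in S -> v = 0); [by left|right].
have [s [sS s0]] : exists s, s \in S /\ s <> 0.
  by apply: contrapT => no; apply: nS0 => s sS; apply: contrapT => s0; apply: no; exists s.
have /asboolP[v vE] := image_valP s.
have N : f l v <> 0 by move=> E; apply: s0; apply: val_inj; rewrite /= -vE E.
move=> t; have /asboolP[w wE] := image_valP t.
have [a aE] := f_cyclic le ln N w.
have -> : t = a *: s + 0 by apply: val_inj; rewrite addr0 linearZ /= -vE -wE -aE linearZ.
by case: Ssub => S0 SS; apply: SS.
Qed.

(** The action factors through the vectors on diagrams from [j] to [l.+2] points, of which none is
    monic. *)
Lemma kills_image j l : (j < l.+2)%N -> kills j (image_module (f l)).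
Proof.
move=> jl x d s; apply: val_inj; rewrite linearZ linear0 /=.
have /asboolP[w <-] := image_valP s; rewrite -linearZ TL_basis_scaleW -act_comp.
by rewrite [act (Some d) _]V_trivial ?linear0.
Qed.

Lemma not_kills_image l : ~~ odd l -> (l.+2 <= n)%N -> ~ kills l.+2 (image_module (f l)).
Proof.
move=> le ln K; have [v N] := f_neq0 le ln; have [d dN] := detect le ln N.
have im u : in_image (f l) (f l u) by apply/asboolP; exists u.
have [c E] := act_end v d.
have c0 : c != 0 by apply/eqP => c0; apply: dN; rewrite E c0 scale0r.
(* Since [d] sends [v] to [c] times the identity, [x d] sends it to [c] times [x]; so [phi] would
   kill every basis vector. *)
apply: N; rewrite fE // -[phi v]/(phil v) [v]basis_decomp linear_sum big1 // => x _.
have := congr1 val (K (val x) d (ImageModule (im v))).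
rewrite linearZ linear0 /= -linearZ TL_basis_scaleW -act_comp E fE //.
rewrite -[phi _]/(phil _) !linearZ /= act_basis compl1 => /eqP.
by rewrite scaler_eq0 (negPf c0) => /eqP ->; rewrite scaler0.
Qed.

Lemma image_iso_eq l l' : ~~ odd l -> (l.+2 <= n)%N -> ~~ odd l' -> (l'.+2 <= n)%N ->
  isomorphic_modules (image_module (f l)) (image_module (f l')) -> l = l'.
Proof.
move=> le ln le' ln' iso; case: (ltngtP l l') => // ll.
  by case: (not_kills_image le ln); apply/(kills_iso _ iso); apply: kills_image.
by case: (not_kills_image le' ln'); apply/(kills_iso _ iso); apply: kills_image.
Qed.

Section Complete.
Variable V : lmodType TLn.
Hypothesis Virr : irreducible_module V.

Lemma kills_minimal : exists k, [/\ (k <= n)%N, ~ kills k V & forall j, (j < k)%N -> kills j V].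
Proof.
pose P k := `[< ~ kills k V >].
have Pn : P n.
  apply/asboolP => K; have [[v /eqP N] _] := Virr; apply: N.
  by have := K (id_diagram n) (id_diagram n) v; rewrite comp1l TL_basis1 scale1r.
case: (ex_minnP (ex_intro _ n Pn)) => k /asboolP Pk kmin; exists k; split=> //.
  exact: kmin.
by move=> j jk; apply: contrapT => /asboolP/kmin; rewrite leqNgt jk.
Qed.

Section Map.
Variables (k : nat) (d : diagram k n) (v : V).
Hypothesis kmin : forall j, (j < k)%N -> kills j V.

(** A diagram with a cap is zero in the standard module but not in the algebra. There it factors
    through [k - 2] strands and acts by zero, as [k] is minimal. *)
Lemma post_comp_scale (o : option (diagram n k)) :
  post_comp d (W_basis F o) *: v = TL_basis F (o ** Some d) *: v.
Proof.
have T0 m : TL_basis F (None : option (diagram m m)) = 0 by apply/ffunP => z; rewrite !ffunE.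
case: o => [z|]; last by rewrite basis_None linear0 None_comp T0.
have [mz|nz] := boolP (monic z).
  by rewrite (@post_comp_basis F n k d (exist _ z mz)).
rewrite (basis_not_monic F nz) linear0 scale0r.
move: z nz d kmin; case: k => [|[|l]] z nz d' km.
- by case/negP: nz; apply/forallP => -[].
- by have := diagram_parity z; rewrite addn1 /= n_even.
have [j [x Hx]] := not_monic_concat nz.
have -> : Some z = Some x ** Some (gamma j) by rewrite -Hx.
rewrite compA; case: (_ ** Some d') => [t|]; last by rewrite comp_None T0 scale0r.
by rewrite (km l).
Qed.

Definition standard_map (w : Wn k) : V := post_comp d w *: v.

Lemma post_comp_act e (w : Wn k) :
  post_comp d (act (Some e) w) *: v = (TL_basis F (Some e) * post_comp d w) *: v.
Proof.
have -> : post_comp d (act (Some e) w) =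
    \sum_y w y *: post_comp d (W_basis F (Some e ** Some (val y))).
  rewrite -[act _ _]/(\sum_y w y *: W_basis F (Some e ** Some (val y))) linear_sum.
  by apply: eq_bigr => y _; apply: linearZ.
rewrite -[post_comp d w]/(\sum_y w y *: TL_basis F (Some (val y) ** Some d)).
rewrite mulr_sumr !scaler_suml; apply: eq_bigr => y _.
by rewrite -scalerAr [LHS]scale_TL [RHS]scale_TL post_comp_scale TL_basisM compA.
Qed.

Lemma standard_map_linear : linear standard_map.
Proof.
move=> a w w'; rewrite /standard_map.
have -> : post_comp d (a *: w + w') = post_comp d (a *: w) + post_comp d w' by exact: linearD.
rewrite scalerDl; congr (_ + _).
have -> : post_comp d (a *: w) = \sum_e a e *: post_comp d (act (Some e) w).
  by rewrite W_scaleE linear_sum; apply: eq_bigr => e _; apply: linearZ.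
rewrite scalerA [in RHS](TL_decomp a) mulr_suml !scaler_suml; apply: eq_bigr => e _.
by rewrite -scalerAl [LHS]scale_TL [RHS]scale_TL post_comp_act.
Qed.

Lemma standard_map_basis (o : option (diagram n k)) :
  standard_map (W_basis F o) = TL_basis F (o ** Some d) *: v.
Proof. exact: post_comp_scale. Qed.

End Map.

Lemma standard_quotient : exists k, [/\ (k <= n)%N, ~~ odd k &
  exists g : {linear Wn k -> V}, forall v, exists w, g w = v].
Proof.
have [k [kn nk kmin]] := kills_minimal; exists k.
have [x [d [v N]]] : exists (x : diagram n k) (d : diagram k n) (v : V),
    TL_basis F (Some x ** Some d) *: v <> 0.
  apply: contrapT => no; apply: nk => x d v; apply: contrapT => N.
  by apply: no; exists x, d, v.
split=> //; first by have := diagram_parity x; rewrite oddD (negPf n_even).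
pose g : {linear Wn k -> V} := HB.pack (standard_map d v)
  (GRing.isLinear.Build TLn (Wn k) V *:%R (standard_map d v) (standard_map_linear d v kmin)).
exists g.
have gx : g (W_basis F (Some x)) <> 0 by rewrite -[g _]/(standard_map _ _ _) standard_map_basis.
have [/(_ _ _)|all v'] := Virr.2 _ (in_image_submod g).
  by move=> all0; case: gx; apply: all0; apply/asboolP; exists (W_basis F (Some x)).
by have /asboolP := all v'.
Qed.

Theorem irreducible_image : exists l, [/\ ~~ odd l, (l.+2 <= n)%N &
  isomorphic_modules V (image_module (f l))].
Proof.
have [k [kn ke [g gsurj]]] := standard_quotient.
have [w0 gw0] : exists w, g w <> 0.
  have [[v vN] _] := Virr; have [w E] := gsurj v; exists w.
  by rewrite E; apply/eqP.
case: k kn ke g gsurj w0 gw0 => [|[//|l]] kn ke g gsurj w0 gw0.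
  have n2 : (2 <= n)%N by lia.
  exists 0%N; split=> //.
  have f0surj w : exists v, f 0 v = w.
    by have [v E] := phil_surj w n_gt0; exists v; rewrite fE.
  pose gf : {linear Wn 2 -> V} := g \o f 0.
  apply: (@image_module_iso _ _ _ _ gf) => [v|u]; first last.
    split=> [gu|fu]; last by rewrite /gf /= fu linear0.
    apply: contrapT => N; apply: gw0; have [v0 <-] := f0surj w0.
    have [a <-] := @f_cyclic 0 u isT n2 N v0.
    have -> : g (f 0 (a *: u)) = a *: gf u by rewrite !linearZ.
    by rewrite gu scaler0.
  by have [w <-] := gsurj v; have [u <-] := f0surj w; exists u.
have le : ~~ odd l by rewrite /= negbK in ke.
exists l; split=> //; apply: (image_module_iso gsurj) => u; split=> [gu|fu].
  apply: contrapT => N; apply: gw0; have [a <-] := f_cyclic le kn N w0.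
  by rewrite linearZ /= gu scaler0.
(* The image of the kernel of [f l] under [g] is 0 or everything. In the latter case some vector
   killed by [g] lies outside that kernel, hence generates, which forces [g = 0]. *)
pose S : {pred V} := fun v => `[< exists w, f l w = 0 /\ g w = v >].
have Ssub : submod_closed S.
  split=> [|a v v']; first by apply/asboolP; exists 0; rewrite !linear0.
  move=> /asboolP[w [fw <-]] /asboolP[w' [fw' <-]]; apply/asboolP.
  by exists (a *: w + w'); rewrite !linearP fw fw' scaler0 addr0.
have [S0|Sall] := Virr.2 S Ssub; first by apply: S0; apply/asboolP; exists u.
have [v N] := f_neq0 le kn.
have /asboolP[w [fw gw]] := Sall (g v).
have N' : f l (v - w) <> 0 by rewrite linearB /= fw subr0.
have [a aE] := f_cyclic le kn N' u.
by rewrite -aE linearZ /= linearB /= gw subrr scaler0.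
Qed.

End Complete.
End Simple.

Theorem theorem1p2 (R : realType) (n : nat) (n_gt0 : (0 < n)%N)
    (n_even : ~~ odd n) :
  exists f : forall l : nat, {linear W R[i] n l.+2 -> W R[i] n l},
  [/\ (* the maps phi are module homomorphisms *)
      forall l, ~~ odd l -> (l.+2 <= n)%N -> forall w, f l w = phi w,
      (* exactness at W_n^n, at the intermediate terms, and at W_0^n *)
      [/\ forall l, l.+2 = n -> injective (@phi R[i] n l),
          forall l, ~~ odd l -> (l.+4 <= n)%N -> forall w : W R[i] n l.+2,
            phi w = 0 <-> exists v : W R[i] n l.+4, phi v = w
        & forall w : W R[i] n 0, exists v : W R[i] n 2, phi v = w] &
      (* the images are the irreducible modules, up to isomorphism *)
      [/\ forall l, ~~ odd l -> (l.+2 <= n)%N ->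
            irreducible_module (image_module (f l)),
          forall l l', ~~ odd l -> (l.+2 <= n)%N -> ~~ odd l' -> (l'.+2 <= n)%N ->
            isomorphic_modules (image_module (f l)) (image_module (f l')) ->
            l = l'
        & forall V : lmodType (TL R[i] n), irreducible_module V ->
            exists l, [/\ ~~ odd l, (l.+2 <= n)%N
              & isomorphic_modules V (image_module (f l))]]].
Proof.
have F0 : [pchar R[i]] =i pred0 := Num.Theory.pchar_num _.
pose f l := sval (cid (phi_hom_exists R[i] n l)).
have fE l : ~~ odd l -> forall w, f l w = phi w by exact: svalP (cid (phi_hom_exists R[i] n l)).
exists f; split.
- by move=> l le _; apply: fE.
- split=> [l ln|l le ln w|w]; last exact: phil_surj.
    by subst n; apply: phil_inj; rewrite /= negbK in n_even.
  exact: (phil_exact w le n_gt0).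
split=> [l le ln|l l' le ln le' ln' |V Virr].
- exact: (image_irreducible F0 n_even fE le ln).
- exact: (image_iso_eq F0 n_even fE le ln le' ln').
exact: (irreducible_image F0 n_gt0 n_even fE Virr).
Qed.
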